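(* Let $n$ be even and $d=d(n)\ge 3$ with $d=o(n^{1/7}/\log n)$. Then there exists a coupling $(P,P')$ such that $P\sim\mathcal P_*(n,d)+\mathcal M_1^+$, $P'\sim\mathcal P_*(n,d+1)$, and $\mathbb P(P=P')=1-O(\log d/d)$.
   Context: $\mathcal P_*(n,d)$ is the configuration model (uniform perfect matching of $nd$ points grouped into $n$ bins of $d$ points, one bin per vertex of $[n]$) conditioned on no pair lying within a single bin; $G[P]$ is the associated multigraph. $\mathcal M_1^+$ is a uniformly random perfect matching on $[n]$, regarded as a pairing with one point per vertex. The superposition $\mathcal P_*(n,d)+\mathcal M_1^+$ is formed from independent samples by taking the union of the points and of the matched pairs, giving a pairing with $d+1$ points per vertex; here $P=P'$ means the resulting multigraphs coincide. *)

(* Defs.v *)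
From mathcomp Require Import all_boot all_order all_algebra.
From mathcomp Require Import reals exp.
Set Implicit Arguments. Unset Strict Implicit. Unset Printing Implicit Defensive.
Import Order.TTheory GRing.Theory Num.Theory.
Local Open Scope ring_scope.

(* Points of the configuration model: vertex v in 'I_n, slot i in 'I_k. *)
Definition point (n k : nat) := ('I_n * 'I_k)%type.

(* A pairing (perfect matching of the points) is encoded by its partner map. *)
Definition pairingfun (n k : nat) := {ffun point n k -> point n k}.

Definition is_pairing (n k : nat) (f : pairingfun n k) : bool :=
  [forall x, (f (f x) == x) && (f x != x)].

Definition is_loopless_pairing (n k : nat) (f : pairingfun n k) : bool :=
  is_pairing f && [forall x, (f x).1 != x.1].

Definition is_perfect_matching (n : nat) (m : {ffun 'I_n -> 'I_n}) : bool :=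
  [forall v, (m (m v) == v) && (m v != v)].

Definition unif (R : realType) (T : finType) (A : pred T) (x : T) : R :=
  if A x then (#|[pred y | A y]|%:R)^-1 else 0.

Definition law_Pstar (R : realType) (n k : nat) (f : pairingfun n k) : R :=
  unif R (@is_loopless_pairing n k) f.

Definition law_M (R : realType) (n : nat) (m : {ffun 'I_n -> 'I_n}) : R :=
  unif R (@is_perfect_matching n) m.

(* Superposition of a pairing with d points per vertex and a perfect matching
   on [n]: the point of the matching at vertex v becomes the (d+1)-th point
   (slot ord_max) of bin v. *)
Definition superpose (n d : nat) (f : pairingfun n d) (m : {ffun 'I_n -> 'I_n}) :
    pairingfun n d.+1 :=
  [ffun x : point n d.+1 =>
     match unlift ord_max x.2 with
     | Some j => let y := f (x.1, j) in (y.1, lift ord_max y.2)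
     | None => (m x.1, ord_max)
     end].

Definition law_super (R : realType) (n d : nat) (g : pairingfun n d.+1) : R :=
  \sum_(f : pairingfun n d) \sum_(m : {ffun 'I_n -> 'I_n})
     law_Pstar R f * law_M R m * (superpose f m == g)%:R.

(* the multigraph G[P]: mult u v = number of points in bin u paired with a
   point in bin v (for u <> v the number of u-v edges, for u = v twice the
   number of loops). *)
Definition multigraph (n k : nat) (f : pairingfun n k) : {ffun 'I_n * 'I_n -> nat} :=
  [ffun uv : 'I_n * 'I_n =>
     #|[set x : point n k | (x.1 == uv.1) && ((f x).1 == uv.2)]|].

Definition is_coupling (R : realType) (T : finType) (p q : T -> R)
    (mu : T * T -> R) : Prop :=
  (forall z, 0 <= mu z) /\
  (forall x, \sum_(y : T) mu (x, y) = p x) /\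
  (forall y, \sum_(x : T) mu (x, y) = q y).

(* Main.v *)
Require Import Defs.
From mathcomp Require Import all_boot all_order all_algebra.
From mathcomp Require Import reals sequences exp.
From mathcomp Require Import perm zify ring lra.
From mathcomp Require functions boolp classical_sets topology normedtype derive set_interval.
Set Implicit Arguments. Unset Strict Implicit. Unset Printing Implicit Defensive.
Import Order.TTheory GRing.Theory Num.Theory.

(** The number of points d+1 per bin being fixed, let X(g) count the layers (one
    point per bin) preserved by a loopless pairing g, i.e. the perfect matchings
    of its multigraph. Exchanging the top point of each bin with a uniformly
    chosen point does not change the multigraph, and turns the superposition into
    the law with density X / E X with respect to P_*(n, d+1). So the multigraphs
    can be coupled with an error of order (E X^2 / (E X)^2 - 1)^(1/2), and the
    point is to bound the relative variance by O(1/d^2).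

    Counting pairs of layers reduces E X and E X^2 to numbers of loopless pairings
    with bins of size d-1, d or d+1. Forbidding loops one point at a time, with
    switchings at each step, shows that loops contribute a factor
    exp(- sum_v C(d_v, 2) / #points) up to a relative error O(d/n). The remaining
    sum over the overlap k of two matchings is dominated by a negative binomial
    law, reweighted by (1 - k/N)^(-1/2) exp(- k/(2N)) = 1 + O((k/N)^2), where
    N = n/2 and k/N is of order 1/d. *)

(** * Perfect matchings of a graph *)

(** The accuracy of the loop factors decides the rate. If loops were allowed, the overlap sum would
    carry the weight (1 - k/N)^(-1/2) alone, which on average exceeds 1 by about 1/(2d); the
    coupling would then fail with probability of order d^(-1/2), more than log d / d. Forbidding
    loops cancels this first-order term, and the error becomes O(1/d). For this, the loop factors
    themselves must be known up to a relative error O(1/d^2), which O(d/n) achieves because d^7 <=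
    n. Since d may grow with n, limit theorems for a fixed degree do not apply, and every estimate
    is an explicit inequality uniform in d. *)

Section Matchings.
Variable T : finType.
Implicit Types (e : rel T) (S A P : {set T}) (f : {ffun T -> T}).

(* A perfect matching of [S] is encoded by its partner map, extended by the
   identity outside [S], so that the matchings of all subsets share one type. *)
Definition matching e S f : bool :=
  [forall x, if x \in S then [&& f x \in S, f x != x, e x (f x) & f (f x) == x]
             else f x == x].

Definition nmatchings e S : nat := #|[set f | matching e S f]|.

Definition sym_on e S := forall x y, x \in S -> y \in S -> e x y = e y x.

Lemma sym_onD e S A : sym_on e S -> sym_on e (S :\: A).
Proof. by move=> h x y /setDP[xS _] /setDP[yS _]; apply: h. Qed.

Lemma sym_onD1 e S z : sym_on e S -> sym_on e (S :\ z).
Proof. exact: sym_onD. Qed.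

Lemma matchingP e S f : reflect
  ((forall x, x \in S -> [/\ f x \in S, f x != x, e x (f x) & f (f x) = x]) /\
   (forall x, x \notin S -> f x = x)) (matching e S f).
Proof.
apply: (iffP forallP) => [h|[h1 h2] x].
  split=> x xS; have := h x; rewrite ?xS ?(negbTE xS).
    by case/and4P=> -> -> -> /eqP ->.
  by move/eqP.
case: ifP => xS; last by rewrite h2 ?xS.
by case: (h1 x xS) => -> -> -> ->; rewrite /=.
Qed.

Lemma eq_nmatchings e e' S : {in S &, forall x y, x != y -> e x y = e' x y} ->
  nmatchings e S = nmatchings e' S.
Proof.
move=> h; apply: eq_card => f; rewrite !inE; apply: eq_forallb => x.
case: ifP => // xS; case fS: (f x \in S) => //=; case: eqVneq => //= fx.
by rewrite h // eq_sym.
Qed.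

Definition unmatch (x y : T) f : {ffun T -> T} :=
  [ffun z => if (z == x) || (z == y) then z else f z].
Definition rematch (x y : T) f : {ffun T -> T} :=
  [ffun z => if z == x then y else if z == y then x else f z].

Lemma nmatchings_fiber e S x y : sym_on e S -> x \in S -> y \in S :\ x -> e x y ->
  #|[set f | matching e S f & f x == y]| = nmatchings e (S :\ x :\ y).
Proof.
move=> es xS; rewrite !inE => /andP[yx yS] exy.
rewrite /nmatchings -!sum1dep_card.
rewrite (reindex_onto (rematch x y) (unmatch x y)) /=; last first.
  move=> f /andP[/matchingP[h1 h2] /eqP fx]; apply/ffunP => z; rewrite !ffunE.
  case: (eqVneq z x) => [->|zx]; first by rewrite fx.
  case: (eqVneq z y) => [->|zy] //=.
  by case: (h1 x xS) => _ _ _; rewrite fx => ->.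
apply: eq_bigl => f; apply/andP/idP.
  move=> [/andP[/matchingP[h1 h2] _] /eqP hf].
  have fE z : f z = if (z == x) || (z == y) then z else rematch x y f z.
    by rewrite -{1}hf ffunE.
  have rE z : z != x -> z != y -> rematch x y f z = f z.
    by move=> zx zy; rewrite ffunE (negbTE zx) (negbTE zy).
  apply/matchingP; split=> z.
    rewrite !inE => /and3P[zy zx zS].
    have [] := h1 z zS; rewrite rE // => fzS fzz ezf.
    have fzx : f z != x.
      apply/eqP => E; have := h1 z zS; rewrite rE // E => -[_ _ _].
      by rewrite ffunE eqxx => /eqP; rewrite eq_sym (negbTE zy).
    have fzy : f z != y.
      apply/eqP => E; have := h1 z zS; rewrite rE // E => -[_ _ _].
      by rewrite ffunE; case: eqP => [E2|_]; [rewrite E2 eqxx in yx | rewrite eqxx => /eqP; rewrite eq_sym (negbTE zx)].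
    by rewrite !rE // fzx fzy fzS fzz ezf => ->.
  rewrite !inE !negb_and !negbK => h; rewrite fE.
  case: (eqVneq z y) h => [->|zy] /=; first by rewrite orbT.
  case: (eqVneq z x) => [->|zx] //= zS.
  by rewrite h2.
move=> /matchingP[h1 h2]; split; last first.
  apply/eqP/ffunP => z; rewrite !ffunE.
  case: (eqVneq z x) => [->|zx] /=; first by rewrite h2 // !inE eqxx andbF.
  by case: (eqVneq z y) => [->|zy] //=; rewrite h2 // !inE eqxx.
rewrite ffunE !eqxx andbT; apply/matchingP; split=> z.
  move=> zS; rewrite !ffunE.
  case: (eqVneq z x) => [->|zx]; first by rewrite (negbTE yx) eqxx yS exy.
  case: (eqVneq z y) => [->|zy]; first by rewrite eqxx xS eq_sym yx es.
  have /h1[] : z \in S :\ x :\ y by rewrite !inE zx zy.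
  by rewrite !inE => /and3P[/negbTE -> /negbTE -> ->] -> -> ->.
move=> zS; rewrite ffunE.
case: (eqVneq z x) => [E|zx]; first by rewrite -E (negbTE zS) in xS.
case: (eqVneq z y) => [E|zy]; first by rewrite -E (negbTE zS) in yS.
by rewrite h2 // !inE (negbTE zS) !andbF.
Qed.

(** The switchings below apply this expansion at two points in succession, so that no map between
    sets of matchings has to be built for them. *)
Lemma nmatchings_rec e S x : sym_on e S -> x \in S ->
  nmatchings e S = \sum_(y in S :\ x | e x y) nmatchings e (S :\ x :\ y).
Proof.
move=> es xS.
rewrite {1}/nmatchings -sum1dep_card.
rewrite (partition_big (fun f : {ffun T -> T} => f x)
           (fun y => (y \in S :\ x) && e x y)) /=.
  apply: eq_bigr => y /andP[yS exy].
  rewrite -(nmatchings_fiber es xS yS exy) -sum1dep_card.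
  by apply: eq_bigl => f.
move=> f /matchingP[h _]; case: (h x xS) => fS fx efx _.
by rewrite !inE fx fS efx.
Qed.

Lemma nmatchings0 e : nmatchings e set0 = 1.
Proof.
rewrite /nmatchings; apply: (@eq_card1 _ [ffun x => x]) => f; rewrite !inE.
apply/matchingP/eqP => [[_ h]|->].
  by apply/ffunP => x; rewrite ffunE h ?inE.
by split=> x; rewrite ?inE ?ffunE.
Qed.

Lemma cardsD2 S x y : x \in S -> y \in S :\ x -> #|S| = #|S :\ x :\ y|.+2.
Proof. by move=> xS yS; rewrite (cardsD1 x) xS (cardsD1 y) yS. Qed.

(* [(2 j - 1)!!] *)
Fixpoint oddfact (j : nat) : nat := if j is j'.+1 then (2 * j').+1 * oddfact j' else 1.
(* [(s - 1)!!] for even [s], and [0] for odd [s]. *)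
Definition ncomplete (s : nat) : nat := if odd s then 0 else oddfact s./2.

Lemma ncompleteS s : ncomplete s.+2 = s.+1 * ncomplete s.
Proof.
rewrite /ncomplete /= negbK; case: ifP => os; first by rewrite muln0.
by rewrite /= mul2n even_halfK ?os.
Qed.

Lemma nmatchings_complete e S : {in S &, forall x y, x != y -> e x y} ->
  nmatchings e S = ncomplete #|S|.
Proof.
move=> h; transitivity (nmatchings (fun _ _ => true) S).
  by apply: eq_nmatchings => x y xS yS xy; rewrite (h x y).
clear h e.
have [s] := ubnP #|S|; elim: s S => // s IH S.
case: (set_0Vmem S) => [->|[x xS]]; first by rewrite nmatchings0 cards0.
rewrite (nmatchings_rec _ xS) //.
move=> leS; have cx := cardsD1 x S; rewrite xS add1n in cx.
case E: #|S :\ x| => [|m].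
  rewrite cx E big1 // => y; rewrite (cards0_eq E) inE //.
rewrite (eq_bigr (fun=> ncomplete m)).
  by rewrite cx E ncompleteS -E -sum1_card big_distrl /=; apply: eq_big => y; rewrite ?andbT ?mul1n.
move=> y /andP[yS _]; rewrite IH; last by rewrite -ltnS -(cardsD2 xS yS); lia.
by congr ncomplete; move: (cardsD2 xS yS); lia.
Qed.

(** Preserving a layer means that no pair crosses its boundary; this turns each such condition into
    a product. *)
Lemma nmatchings_split e S A : sym_on e S ->
  nmatchings (fun x y => e x y && ((x \in A) == (y \in A))) S =
  nmatchings e (S :&: A) * nmatchings e (S :\: A).
Proof.
have [s] := ubnP #|S|; elim: s S => // s IH S ltS es.
set e' := fun x y => _.
have es' : sym_on e' S by move=> x y xS yS; rewrite /e' es // eq_sym.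
case: (set_0Vmem S) => [->|[x xS]]; first by rewrite set0I set0D !nmatchings0.
rewrite (nmatchings_rec es' xS).
have IH' y : y \in S :\ x -> nmatchings e' (S :\ x :\ y) =
    nmatchings e ((S :\ x :\ y) :&: A) * nmatchings e ((S :\ x :\ y) :\: A).
  move=> yS; apply: IH; last exact: sym_onD1 (sym_onD1 es).
  by move: (cardsD2 xS yS) ltS; lia.
case xA: (x \in A).
  rewrite (@nmatchings_rec e (S :&: A) x); last by rewrite inE xS xA.
    rewrite big_distrl /=; apply: eq_big => y.
      by rewrite /e' !inE xA; case: (y \in A); rewrite ?andbT ?andbF.
    case/andP=> yS; rewrite /e' xA => /andP[_ /eqP/esym yA].
    rewrite IH' //; congr (nmatchings e _ * nmatchings e _); apply/setP => z; rewrite !inE.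
      by rewrite -!andbA.
    case: (eqVneq z y) => [->|_]; first by rewrite yA.
    by case: (eqVneq z x) => [->|_]; first by rewrite xA.
  by move=> a b /setIP[aS _] /setIP[bS _]; apply: es.
rewrite (@nmatchings_rec e (S :\: A) x); first last.
- by rewrite inE xS xA.
- exact: sym_onD.
rewrite big_distrr /=; apply: eq_big => y.
  by rewrite /e' !inE xA; case: (y \in A); rewrite ?andbT ?andbF.
case/andP=> yS; rewrite /e' xA => /andP[_ /eqP/esym yA].
rewrite IH' //; congr (nmatchings e _ * nmatchings e _); apply/setP => z; rewrite !inE.
  case: (eqVneq z y) => [->|_]; first by rewrite yA !andbF.
  by case: (eqVneq z x) => [->|_]; first by rewrite xA !andbF.
by case: (z \in A); rewrite /= ?andbF.
Qed.

End Matchings.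

(** * Switchings *)

Section Switching.
Variable T : finType.
Implicit Types (e : rel T) (S A P : {set T}).

Definition nonadj_le e S (k : nat) :=
  forall x, x \in S -> #|[set y in S :\ x | ~~ e x y]| <= k.

Lemma nonadj_leD1 e S k z : nonadj_le e S k -> nonadj_le e (S :\ z) k.
Proof.
move=> h x /setD1P[_ xS]; apply: leq_trans (h x xS); apply: subset_leq_card.
by apply/subsetP => y; rewrite !inE => /andP[/and3P[-> _ ->] ->].
Qed.

Lemma sum_subset (S A : {set T}) (F : T -> nat) : A \subset S ->
  \sum_(x in A) F x <= \sum_(x in S) F x.
Proof.
move=> sAS; rewrite [leqRHS](big_setID A) /= (setIidPr sAS); exact: leq_addr.
Qed.

Lemma setD1C S x y : S :\ x :\ y = S :\ y :\ x.
Proof. by apply/setP => z; rewrite !inE andbCA. Qed.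

(* Replacing the pairs [yw] and [uv] by [yu] and [wv] is injective; it fails
   only when [u] is not adjacent to [y] or [v] is not adjacent to [w]. *)
Lemma switch_le e S k y w : sym_on e S -> nonadj_le e S k ->
  y \in S -> w \in S :\ y ->
  #|S :\ y :\ w| * nmatchings e (S :\ y :\ w) <=
  nmatchings e S + 2 * k * nmatchings e (S :\ y :\ w).
Proof.
move=> es hk yS wS; set S' := S :\ y :\ w; set Q := nmatchings e S'.
have es' : sym_on e S' by apply/sym_onD1/sym_onD1.
have hw : w \in S by case/setD1P: wS.
have wy : w != y by case/setD1P: wS.
have sub z : z \in S' -> z \in S by rewrite !inE => /and3P[].
pose N u v := nmatchings e (S' :\ v :\ u).
have Q1 v : v \in S' -> Q = \sum_(u in S' :\ v | e v u) N u v.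
  by move=> vS; rewrite /Q (nmatchings_rec es' vS).
have -> : #|S'| * Q = \sum_(v in S') \sum_(u in S' :\ v | e v u) N u v.
  by rewrite -sum1_card big_distrl /=; apply: eq_bigr => v vS; rewrite mul1n -Q1.
(* [s1] collects the pairs that can be switched, [s2] and [s3] the two kinds of failure. Once the
   endpoint responsible for the failure is fixed (at most [k] choices), summing over its partner
   gives at most [Q]. *)
pose s1 := \sum_(v in S') \sum_(u in S' :\ v | e y u && e w v) N u v.
pose s2 := \sum_(v in S') \sum_(u in S' :\ v | e v u && ~~ e y u) N u v.
pose s3 := \sum_(v in S') \sum_(u in S' :\ v | e v u && ~~ e w v) N u v.
have h : \sum_(v in S') \sum_(u in S' :\ v | e v u) N u v <= s1 + s2 + s3.
  rewrite /s1 /s2 /s3 -!big_split /=; apply: leq_sum => v vS.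
  rewrite !big_mkcondr /= -!big_split /=; apply: leq_sum => u uS.
  by case: (e v u); case: (e y u); case: (e w v); rewrite /= ?addn0 ?add0n ?leq_addr.
apply: leq_trans h _; rewrite -addnA; apply: leq_add.
  rewrite (nmatchings_rec es yS) /s1.
  rewrite (exchange_big_dep (fun u => (u \in S') && e y u)) /=; last first.
    by move=> v u _ /andP[/setD1P[_ ->] /andP[-> _]].
  apply: (@leq_trans (\sum_(u in S' | e y u) nmatchings e (S :\ y :\ u))).
    apply: leq_sum => u /andP[uS eyu].
    have wu : w \in S :\ y :\ u.
      by move: uS; rewrite !inE hw wy => /and3P[uw _ _]; rewrite eq_sym uw.
    rewrite (nmatchings_rec _ wu); last by apply/sym_onD1/sym_onD1.
    rewrite eq_leq //; apply: eq_big => v.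
      move: uS; rewrite !inE => /and3P[uw uy uS]; rewrite uw uy uS eyu (eq_sym u v) /=.
      by case: (v == u); case: (v == w); case: (v == y); case: (v \in S); case: (e w v).
    by move=> _; rewrite /N; congr nmatchings; rewrite /S' (setD1C (S :\ y) u w) setD1C.
  rewrite !big_mkcondr /=; apply: sum_subset; exact: subsetDl.
rewrite mul2n -addnn mulnDl; apply: leq_add.
  rewrite /s2 (exchange_big_dep (fun u => (u \in S') && ~~ e y u)) /=; last first.
    by move=> v u _ /andP[/setD1P[_ ->] /andP[_ ->]].
  apply: (@leq_trans (\sum_(u in S' | ~~ e y u) Q)).
    apply: leq_sum => u /andP[uS eyu]; rewrite (Q1 u uS).
    rewrite eq_leq //; apply: eq_big => v.
      move: (uS); rewrite !inE => /and3P[uw uy uS']; rewrite uw uy uS' eyu (eq_sym u v) /=.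
      case vS: (v \in S); rewrite /= ?andbF // (es u v) //.
      by case: (v == u); case: (v == w); case: (v == y); case: (e v u).
    by move=> _; rewrite /N setD1C.
  rewrite sum_nat_const leq_mul2r; apply/orP; right.
  apply: leq_trans (hk y yS); apply: subset_leq_card.
  by apply/subsetP => u /andP[]; rewrite !inE => /and3P[_ -> ->] ->.
rewrite /s3; apply: (@leq_trans (\sum_(v in S' | ~~ e w v) Q)).
  rewrite [leqRHS]big_mkcondr /=; apply: leq_sum => v vS; case: ifP => ewv.
    by rewrite (Q1 v vS) eq_leq //; apply: eq_bigl => u; rewrite andbT.
  by rewrite big1 // => u; rewrite !andbF.
rewrite sum_nat_const leq_mul2r; apply/orP; right.
apply: leq_trans (hk w hw); apply: subset_leq_card.
by apply/subsetP => u /andP[]; rewrite !inE => /and3P[-> _ ->] ->.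
Qed.

(** Holds for a point at which loops are not yet forbidden. *)
Definition free_in e S x := forall y, y \in S :\ x -> e x y.

Lemma free_edge_le e S k x y : sym_on e S -> nonadj_le e S k ->
  x \in S -> y \in S :\ x -> #|S| >= 2 * k + 2 ->
  (#|S| - (2 * k + 2)) * nmatchings e (S :\ x :\ y) <= nmatchings e S.
Proof.
move=> es hk xS yS leS; have := switch_le es hk xS yS.
move: (cardsD2 xS yS) leS => -> ; set q := #|_|; set M := nmatchings _ _; nia.
Qed.

(* The number of matchings containing [xz] barely depends on [z]: expand it along
   [y], expand the number of those containing [xy] along [z], and compare. *)
Lemma free_edge_ge e S k x y : sym_on e S -> nonadj_le e S k ->
  x \in S -> y \in S :\ x -> free_in e S x -> #|S| >= 4 * k + 6 ->
  nmatchings e S <= (#|S| + 2 * k) * nmatchings e (S :\ x :\ y).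
Proof.
move=> es hk xS yS fx leS; set Q := nmatchings e (S :\ x :\ y).
pose U := S :\ x :\ y.
have cS := cardsD2 xS yS.
have eU : sym_on e U by apply/sym_onD1/sym_onD1.
have hy : y \in S by case/setD1P: yS.
have yx : y != x by case/setD1P: yS.
have step z : z \in U -> nmatchings e (S :\ x :\ z) <=
    Q + \sum_(w in U :\ z | ~~ e z w) nmatchings e (U :\ z :\ w).
  move=> zU; move: (zU); rewrite /U !inE => /and3P[zy zx zS].
  have yz : y \in S :\ x :\ z by rewrite !inE eq_sym zy yx hy.
  rewrite (nmatchings_rec _ yz); last by apply/sym_onD1/sym_onD1.
  rewrite /Q (nmatchings_rec eU zU) (setD1C (S :\ x) z y) -/U.
  rewrite !big_mkcondr /= -big_split /=; apply: leq_sum => w wU.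
  by case: (e z w); case: (e y w); rewrite /= ?addn0 ?leq_addr.
rewrite (nmatchings_rec es xS) (bigD1 y) /=; last by rewrite yS fx.
rewrite -/Q.
have h1 : \sum_(i | (i \in S :\ x) && e x i && (i != y)) nmatchings e (S :\ x :\ i)
   <= \sum_(z in U) (Q + \sum_(w in U :\ z | ~~ e z w) nmatchings e (U :\ z :\ w)).
  rewrite (eq_bigl (fun z => z \in U)); first by apply: leq_sum => z; apply: step.
  move=> z; rewrite !inE /=; case: (eqVneq z y) => [->|] /=; rewrite ?andbF ?andbT //.
  by move=> _; case: (eqVneq z x) => //= zx; case zS: (z \in S) => //=; rewrite fx // !inE zx zS.
have cU : 2 * k <= #|U| - 2 by move: cS leS; rewrite /U; lia.
have h2 z : z \in U -> (#|U| - (2 * k + 2)) * \sum_(w in U :\ z | ~~ e z w) nmatchings e (U :\ z :\ w) <= k * Q.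
  move=> zU; rewrite big_distrr /=.
  apply: (@leq_trans (\sum_(w in U :\ z | ~~ e z w) Q)).
    apply: leq_sum => w /andP[wU _]; apply: free_edge_le => //.
      by apply/nonadj_leD1/nonadj_leD1.
    by move: cS leS; rewrite /U; lia.
  rewrite sum_nat_const leq_mul2r; apply/orP; right.
  have hU : nonadj_le e U k by apply/nonadj_leD1/nonadj_leD1.
  by apply: leq_trans (hU z zU); apply: subset_leq_card; apply/subsetP => w; rewrite inE.
move: h1; rewrite big_split /= sum_nat_const => h1.
have h3 : (#|U| - (2 * k + 2)) * \sum_(z in U) \sum_(w in U :\ z | ~~ e z w) nmatchings e (U :\ z :\ w) <= #|U| * (k * Q).
  by rewrite big_distrr /= -sum_nat_const; apply: leq_sum => z; apply: h2.
apply: leq_trans (leq_add (leqnn Q) h1) _.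
move: h3 cS leS; rewrite -/U; set B := \sum_(z in U) _; set q := #|U| => h3 -> leS.
have q2 : 0 < q - (2 * k + 2) by lia.
have : B <= 2 * k * Q.
  rewrite -(leq_pmul2l q2); apply: leq_trans h3 _.
  (* This is where the assumption [#|S| >= 4 * k + 6] enters: dividing by [q - (2 * k + 2)] instead
     of [q] costs at most a factor 2. *)
  have : q <= 2 * (q - (2 * k + 2)) by lia.
  set q' := q - _; nia.
nia.
Qed.

End Switching.

(** * Loopless pairings with prescribed bins *)

Section Bins.
Variables (T V : finType) (b : T -> V).
Implicit Types (S A P : {set T}).

(* Loops are forbidden only between points of [P]; [P] grows one point at a time
   from the empty set (all pairings) to all points (loopless pairings). *)
Definition loopless_on P : rel T := fun x y => ~~ [&& x \in P, y \in P & b x == b y].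

Definition siblings P x := [set y in P :\ x | b y == b x].

(* Ordered pairs, hence twice the usual [sum_v C(d_v, 2)]. *)
Definition loop_pairs P : nat := \sum_(x in P) #|siblings P x|.

Lemma loopless_on_sym P S : sym_on (loopless_on P) S.
Proof. by move=> x y _ _; rewrite /loopless_on eq_sym andbCA. Qed.

Lemma loopless_on_nonadj P S k : P \subset S ->
  (forall x, x \in S -> #|siblings S x| <= k) -> nonadj_le (loopless_on P) S k.
Proof.
move=> PS h x xS; apply: leq_trans (h x xS); apply/subset_leq_card/subsetP => y.
by rewrite !inE negbK (eq_sym (b x)) => /andP[-> /and3P[_ _ ->]].
Qed.

(** The matchings lost are those that pair [x] with a sibling in [P]. Once [x] is matched, the
    relations for [P] and [x |: P] agree on the remaining points. *)
Lemma loopless_onU1 P S x : x \in S -> x \notin P -> P \subset S ->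
  nmatchings (loopless_on P) S =
  nmatchings (loopless_on (x |: P)) S +
  \sum_(y in siblings P x) nmatchings (loopless_on P) (S :\ x :\ y).
Proof.
move=> xS xP PS.
rewrite !(@nmatchings_rec _ _ S x) //; try exact: loopless_on_sym.
rewrite (bigID (fun y => y \in siblings P x)) /= addnC; congr (_ + _).
  apply: eq_big => y.
    rewrite /loopless_on !inE eqxx (negbTE xP) /= andbT (eq_sym (b x)).
    by case: (eqVneq y x) => //= yx; case: (y \in P); case: (y \in S).
  case/andP => _ _; apply: eq_nmatchings => z w; rewrite !inE.
  by move=> /and3P[_ /negbTE zx _] /and3P[_ /negbTE wx _] _; rewrite /loopless_on !inE zx wx.
apply: eq_bigl => y; rewrite /loopless_on !inE (negbTE xP) /= andbT.
case: (eqVneq y x) => //= yx; case yP: (y \in P); rewrite ?andbF //.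
by rewrite (subsetP PS) //=.
Qed.

Lemma loop_pairsU1 P x : x \notin P ->
  loop_pairs (x |: P) = loop_pairs P + 2 * #|siblings P x|.
Proof.
move=> xP; rewrite /loop_pairs big_setU1 //=.
have -> : siblings (x |: P) x = siblings P x.
  by apply/setP => y; rewrite !inE; case: (eqVneq y x).
have h y : y \in P -> #|siblings (x |: P) y| = #|siblings P y| + (y \in siblings P x).
  move=> yP; rewrite (cardsD1 x) addnC; congr (_ + _).
    apply: eq_card => z; rewrite !inE; case: (eqVneq z x) => [->|] //=.
    by rewrite (negbTE xP) andbF.
  by rewrite !inE eqxx yP (eq_sym x) (eq_sym (b x)) andbT.
rewrite (eq_bigr _ h) big_split /= addnCA; congr (_ + _).
rewrite mul2n -addnn; congr (_ + _).
rewrite -sum1_card big_mkcond [RHS]big_mkcond /=; apply: eq_bigr => y _.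
by rewrite !inE; case: (y \in P); rewrite ?andbF //=; case: (_ && _).
Qed.

Local Open Scope ring_scope.

Section Estimates.
Variables (R : realType) (S : {set T}) (k : nat).
Hypotheses (hk : forall x, x \in S -> (#|siblings S x| <= k)%N)
           (hS : (4 * k + 6 <= #|S|)%N).

Let s : R := #|S|%:R.
Let F P : R := (nmatchings (loopless_on P) S)%:R.

Lemma card_ge : 4 * k%:R + 6 <= s.
Proof. by move: hS; rewrite -(ler_nat R) natrD natrM. Qed.

Lemma siblings_le P x : P \subset S -> x \in S -> (#|siblings P x| <= k)%N.
Proof.
move=> PS xS; apply: leq_trans (hk xS); apply/subset_leq_card/subsetP => y.
by rewrite !inE => /andP[/andP[-> /(subsetP PS) ->] ->].
Qed.

(** As [x] is outside [P], it is adjacent to every other point, so [free_edge_ge] and [free_edge_le]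
    bound from below and above the share of matchings through each lost pair. *)
Lemma loopless_step P x : P \subset S -> x \in S -> x \notin P ->
  F (x |: P) <= F P * (1 - #|siblings P x|%:R / (s + 2 * k%:R)) /\
  F P * (1 - #|siblings P x|%:R / (s - 2 * k%:R - 2)) <= F (x |: P).
Proof.
move=> PS xS xP.
have sk := card_ge.
have k0 : (0 : R) <= k%:R by [].
have := loopless_onU1 xS xP PS => /(congr1 (fun n => n%:R : R)).
rewrite natrD natr_sum -/(F _) -/(F _).
set q := \sum_(y in _) _ => E.
have nadj := loopless_on_nonadj PS hk.
have sym := @loopless_on_sym P S.
have inS y : y \in siblings P x -> y \in S :\ x.
  by rewrite !inE => /andP[/andP[-> /(subsetP PS) ->]].
have fr : free_in (loopless_on P) S x by move=> y _; rewrite /loopless_on (negbTE xP).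
have q1 : F P / (s + 2 * k%:R) * #|siblings P x|%:R <= q.
  rewrite mulr_natr -sumr_const; apply: ler_sum => y yx.
  rewrite ler_pdivrMr; last by lra.
  rewrite /F /s -natrM -natrD -natrM ler_nat mulnC; apply: free_edge_ge => //.
  exact: inS.
have q2 : q <= F P / (s - 2 * k%:R - 2) * #|siblings P x|%:R.
  rewrite mulr_natr -sumr_const; apply: ler_sum => y yx.
  rewrite ler_pdivlMr; last by lra.
  have -> : s - 2 * k%:R - 2 = (#|S| - (2 * k + 2))%N%:R.
    by rewrite natrB ?natrD ?natrM /s; [ring | lia].
  rewrite /F -natrM ler_nat mulnC; apply: free_edge_le => //; first exact: inS.
  by lia.
have dE (c : R) : F P * (1 - #|siblings P x|%:R / c) = F P - F P / c * #|siblings P x|%:R by ring.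
by rewrite !dE; split; lra.
Qed.

(** Multiplies the steps from the empty set up to [P], with 1 - t <= exp(-t). Each pair of siblings
    is met once, when its second point is added, whence the half of [loop_pairs]. *)
Lemma loopless_le P : P \subset S ->
  F P <= (ncomplete #|S|)%:R * expR (- ((loop_pairs P)%:R / 2 / (s + 2 * k%:R))).
Proof.
have [n] := ubnP #|P|; elim: n P => // n IH P.
have sk := card_ge.
have k0 : (0 : R) <= k%:R by [].
case: (set_0Vmem P) => [->|[x xP]] ltP PS.
  rewrite /loop_pairs big_set0 !mul0r oppr0 expR0 mulr1 /F ler_nat.
  by rewrite nmatchings_complete // => y z _ _ _; rewrite /loopless_on inE.
have PE : P = x |: (P :\ x) by rewrite setD1K.
have xP' : x \notin P :\ x by rewrite !inE eqxx.
have PS' : P :\ x \subset S by apply: subset_trans PS; apply: subsetDl.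
have xS := subsetP PS _ xP.
rewrite PE; have [h _] := loopless_step PS' xS xP'.
rewrite loop_pairsU1 //; apply: le_trans h _.
have lt' : (#|P :\ x| < n)%N by move: ltP; rewrite (cardsD1 x) xP.
have {}IH := IH _ lt' PS'.
have -> : - ((loop_pairs (P :\ x) + 2 * #|siblings (P :\ x) x|)%:R / 2 / (s + 2 * k%:R)) =
  - ((loop_pairs (P :\ x))%:R / 2 / (s + 2 * k%:R)) +
  - (#|siblings (P :\ x) x|%:R / (s + 2 * k%:R)).
  by rewrite natrD natrM; field; lra.
rewrite expRD mulrA; apply: le_trans (_ : F (P :\ x) * expR (- (#|siblings (P :\ x) x|%:R / (s + 2 * k%:R))) <= _).
  by apply: ler_wpM2l => //; apply: expR_ge1Dx.
by apply: ler_wpM2r => //; apply: expR_ge0.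
Qed.

(** The denominator is smaller by [k] than in [loopless_step]: this pays for turning the factors 1 -
    t into exponentials from below. *)
Lemma loopless_ge P : P \subset S ->
  (ncomplete #|S|)%:R * expR (- ((loop_pairs P)%:R / 2 / (s - 3 * k%:R - 2))) <= F P.
Proof.
have [n] := ubnP #|P|; elim: n P => // n IH P.
have sk := card_ge.
have k0 : (0 : R) <= k%:R by [].
case: (set_0Vmem P) => [->|[x xP]] ltP PS.
  rewrite /loop_pairs big_set0 !mul0r oppr0 expR0 mulr1 /F ler_nat.
  by rewrite nmatchings_complete // => y z _ _ _; rewrite /loopless_on inE.
have PE : P = x |: (P :\ x) by rewrite setD1K.
have xP' : x \notin P :\ x by rewrite !inE eqxx.
have PS' : P :\ x \subset S by apply: subset_trans PS; apply: subsetDl.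
have xS := subsetP PS _ xP.
have [_] := loopless_step PS' xS xP'; rewrite -PE => /(le_trans _); apply.
rewrite {1}PE loop_pairsU1 //.
have lt' : (#|P :\ x| < n)%N by move: ltP; rewrite (cardsD1 x) xP.
have {}IH := IH _ lt' PS'.
have -> : - ((loop_pairs (P :\ x) + 2 * #|siblings (P :\ x) x|)%:R / 2 / (s - 3 * k%:R - 2)) =
  - ((loop_pairs (P :\ x))%:R / 2 / (s - 3 * k%:R - 2)) +
  - (#|siblings (P :\ x) x|%:R / (s - 3 * k%:R - 2)).
  by rewrite natrD natrM; field; lra.
rewrite expRD mulrA.
have hb : (#|siblings (P :\ x) x|%:R : R) <= k%:R by rewrite ler_nat siblings_le.
set u := #|siblings (P :\ x) x|%:R in hb *.
have u0 : (0 : R) <= u by [].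
apply: ler_pM => //; try exact: expR_ge0.
  by rewrite mulr_ge0 ?expR_ge0.
(* exp (u / (a - u)) >= 1 + u / (a - u) = 1 / (1 - u / a) *)
set a := s - 2 * k%:R - 2.
have a0 : 0 < a - u by rewrite /a; lra.
have -> : 1 - u / a = (1 + u / (a - u))^-1 by field; rewrite /a; lra.
rewrite expRN lef_pV2 ?posrE ?expR_gt0 //; last first.
  by apply: ltr_pwDl => //; rewrite divr_ge0 // ltW.
apply: (le_trans (expR_ge1Dx _)); rewrite ler_expR; apply: ler_wpM2l => //.
by rewrite lef_pV2 ?posrE // /a; lra.
Qed.

End Estimates.
End Bins.

Lemma loop_pairsE (T V : finType) (b : T -> V) (S : {set T}) :
  loop_pairs b S = \sum_v #|[set x in S | b x == v]| * #|[set x in S | b x == v]|.-1.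
Proof.
rewrite /loop_pairs (partition_big b xpredT) //=; apply: eq_bigr => v _.
rewrite -[X in _ = X * _]sum1_card big_distrl /=.
apply: eq_big => [x|x /andP[xS /eqP bx]]; first by rewrite inE.
rewrite mul1n [X in _ = X.-1](cardsD1 x) !inE xS bx eqxx /=; apply: eq_card => y.
by rewrite !inE bx andbA.
Qed.

(** * Pairings preserving transversal layers *)

Section Layers.
Variables (n d : nat).
Notation pt := (point n d.+1).
Notation slots := {ffun 'I_n -> 'I_d.+1}.
Implicit Types (i j : slots) (g : pairingfun n d.+1).

Definition distinct_bins : rel pt := fun x y => x.1 != y.1.

Lemma distinct_bins_sym S : sym_on distinct_bins S.
Proof. by move=> x y _ _; rewrite /distinct_bins eq_sym. Qed.

(* A perfect matching of the bins inside a pairing, together with the points it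
   uses, amounts to a layer (one point per bin) preserved by the pairing. *)
Definition layer i : {set pt} := [set x | x.2 == i x.1].

Definition preserves i g := [forall x in layer i, g x \in layer i].

Definition agreement i j : {set 'I_n} := [set v | i v == j v].

Lemma loopless_matching g :
  is_loopless_pairing g = matching distinct_bins setT g.
Proof.
apply/andP/matchingP => [[/forallP h1 /forallP h2]|[h _]].
  split=> x; rewrite !inE // => _; have /andP[/eqP -> ->] := h1 x.
  by rewrite /distinct_bins eq_sym h2.
split; apply/forallP => x; have [_ gx eb ggx] := h x (in_setT _).
  by rewrite ggx eqxx.
by rewrite eq_sym.
Qed.

Lemma preservesP i g : is_loopless_pairing g ->
  reflect (forall x, (x \in layer i) = (g x \in layer i)) (preserves i g).
Proof.
move=> /andP[/forallP h _]; apply: (iffP forallP) => [pg x|pg x].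
  have /andP[/eqP ggx _] := h x.
  apply/idP/idP => xi; first by have /implyP := pg x; apply.
  by have /implyP/(_ xi) := pg (g x); rewrite ggx.
by apply/implyP; rewrite pg.
Qed.

Lemma card_preserves2 i j :
  #|[set g | [&& is_loopless_pairing g, preserves i g & preserves j g]]| =
  nmatchings (fun x y => (distinct_bins x y && ((x \in layer i) == (y \in layer i)))
                         && ((x \in layer j) == (y \in layer j))) setT.
Proof.
apply: eq_card => g; rewrite !inE; apply/and3P/matchingP.
  move=> [lg /(preservesP _ lg) pi /(preservesP _ lg) pj]; split=> x; last by rewrite inE.
  move=> _; move: lg; rewrite loopless_matching => /matchingP[/(_ x (in_setT _))[-> -> -> ->] _].
  by rewrite /= -pi -pj !eqxx.
move=> [h _].
have lg : is_loopless_pairing g.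
  rewrite loopless_matching; apply/matchingP; split => x; rewrite ?inE // => _.
  by have [_ gx /andP[/andP[ex _] _] ggx] := h x (in_setT _).
split=> //; apply/(preservesP _ lg) => x;
  by have [_ _ /andP[/andP[_ /eqP h1] /eqP h2] _] := h x (in_setT _).
Qed.

(** No two points of a layer share a bin, so loops cannot occur there and the count is exact. *)
Lemma nmatchings_layer i (p : pred 'I_n) :
  nmatchings distinct_bins [set x in layer i | p x.1] = ncomplete #|p|.
Proof.
rewrite nmatchings_complete; last first.
  move=> [v s] [w t]; rewrite !inE /distinct_bins /= => /andP[/eqP -> _] /andP[/eqP -> _].
  by apply: contraNN => /eqP ->.
rewrite -(card_imset p (fun v w (h : (v, i v) = (w, i w)) => congr1 fst h)); congr ncomplete.
apply: eq_card => -[v s]; rewrite !inE /=; apply/andP/imsetP => [[/eqP -> pv]|[w pw [-> ->]]].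
  by exists v.
by rewrite eqxx.
Qed.

(** The two layers cut the points into their common part, their two differences and the rest, and no
    pair crosses. The first three parts lie inside a layer; only the rest requires an estimate. *)
Lemma card_preserves2E i j :
  #|[set g | [&& is_loopless_pairing g, preserves i g & preserves j g]]| =
  ncomplete #|agreement i j| * ncomplete (n - #|agreement i j|) ^ 2 *
  nmatchings distinct_bins (~: (layer i :|: layer j)).
Proof.
have an : #|~: agreement i j| = n - #|agreement i j| by rewrite cardsCs setCK card_ord.
rewrite card_preserves2 nmatchings_split; last first.
  by move=> x y _ _; rewrite /distinct_bins eq_sym [X in _ && X]eq_sym.
rewrite !nmatchings_split; try exact: distinct_bins_sym.
rewrite !(setTI, setTD).
have -> : layer j :&: layer i = [set x in layer i | x.1 \in agreement i j].
  apply/setP => x; rewrite !inE.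
  by apply/andP/andP => -[/eqP h1 /eqP h2]; rewrite h1 ?h2 -1?h1 -1?h2 ?h1 eqxx.
have -> : ~: layer j :&: layer i = [set x in layer i | x.1 \in ~: agreement i j].
  apply/setP => x; rewrite !inE; rewrite andbC.
  by case: (x.2 =P i x.1) => //= ->.
have -> : layer j :\: layer i = [set x in layer j | x.1 \in ~: agreement i j].
  apply/setP => x; rewrite !inE andbC.
  by case: (x.2 =P j x.1) => //= ->; rewrite eq_sym.
have -> : ~: layer j :\: layer i = ~: (layer i :|: layer j).
  by apply/setP => x; rewrite !inE negb_or.
by rewrite !nmatchings_layer an; ring.
Qed.

Lemma agreement_id i : agreement i i = setT.
Proof. by apply/setP => v; rewrite !inE eqxx. Qed.

Lemma card_preserves i :
  #|[set g | is_loopless_pairing g && preserves i g]| =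
  ncomplete n * nmatchings distinct_bins (~: layer i).
Proof.
have := card_preserves2E i i; rewrite setUid agreement_id cardsT card_ord subnn muln1 => <-.
by apply: eq_card => g; rewrite !inE andbb.
Qed.

Lemma fiber_rest i j v :
  #|[set x in ~: (layer i :|: layer j) | x.1 == v]| =
  if v \in agreement i j then d else d.-1.
Proof.
have -> : [set x in ~: (layer i :|: layer j) | x.1 == v] =
   [set (v, s) | s in ~: [set i v; j v]].
  apply/setP => -[w s]; rewrite !inE /=; apply/andP/imsetP => [[h /eqP E]|[t + [-> ->]]].
    by exists s; rewrite ?E // !inE -E.
  by rewrite !inE => ->; rewrite eqxx.
rewrite card_imset; last by move=> s t [].
by rewrite cardsCs setCK card_ord cards2 !inE; case: eqP => _; rewrite /= ?subSS ?subn0 ?subn1.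
Qed.

Lemma card_fibers (S : {set pt}) : #|S| = \sum_v #|[set x in S | x.1 == v]|.
Proof.
rewrite -sum1_card (partition_big fst xpredT) //=; apply: eq_bigr => v _.
by rewrite -sum1_card; apply: eq_bigl => x; rewrite inE.
Qed.

Lemma sum_agreement i j (a c : nat) :
  \sum_v (if v \in agreement i j then a else c) =
  #|agreement i j| * a + (n - #|agreement i j|) * c.
Proof.
rewrite (bigID (mem (agreement i j))) /=; congr (_ + _).
  by rewrite -sum_nat_const; apply: eq_bigr => v ->.
have <- : #|~: agreement i j| = n - #|agreement i j| by rewrite cardsCs setCK card_ord.
rewrite -sum_nat_const; apply: eq_big => v; first by rewrite in_setC.
by move/negbTE ->.
Qed.

Lemma card_rest i j :
  #|~: (layer i :|: layer j)| = #|agreement i j| * d + (n - #|agreement i j|) * d.-1.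
Proof.
rewrite card_fibers -sum_agreement; apply: eq_bigr => v _; exact: fiber_rest.
Qed.

Lemma loop_pairs_rest i j :
  loop_pairs fst (~: (layer i :|: layer j)) =
  #|agreement i j| * (d * d.-1) + (n - #|agreement i j|) * (d.-1 * d.-2).
Proof.
rewrite loop_pairsE -sum_agreement; apply: eq_bigr => v _; rewrite fiber_rest.
by case: ifP.
Qed.

Lemma siblings_le_point (S : {set pt}) x : #|siblings fst S x| <= d.
Proof.
apply: (@leq_trans #|[set (x.1, s) | s in ~: [set x.2]]|).
  apply/subset_leq_card/subsetP => -[w s]; rewrite !inE /= => /andP[/andP[h _] /eqP E].
  apply/imsetP; exists s; last by rewrite E.
  by rewrite !inE; apply: contraNN h => /eqP ->; rewrite E -surjective_pairing.
by apply: leq_trans (leq_imset_card _ _) _; rewrite cardsCs setCK card_ord cards1 subn1.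
Qed.

Lemma distinct_bins_loopless (S : {set pt}) :
  nmatchings distinct_bins S = nmatchings (loopless_on fst S) S.
Proof. by apply: eq_nmatchings => x y xS yS _; rewrite /loopless_on xS yS. Qed.

Lemma fiber_setT v : #|[set x in [set: pt] | x.1 == v]| = d.+1.
Proof.
have -> : [set x in [set: pt] | x.1 == v] = [set (v, s) | s in 'I_d.+1].
  apply/setP => -[w s]; rewrite !inE /=; apply/eqP/imsetP => [->|[t _ [-> _]] //].
  by exists s.
by rewrite card_imset ?card_ord // => s t [].
Qed.

Lemma loop_pairs_setT : loop_pairs fst [set: pt] = n * (d.+1 * d).
Proof.
rewrite loop_pairsE (eq_bigr (fun=> d.+1 * d)) => [|v _]; last by rewrite fiber_setT.
by rewrite sum_nat_const card_ord.
Qed.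

Lemma card_loopless :
  #|[set g : pairingfun n d.+1 | is_loopless_pairing g]| = nmatchings distinct_bins setT.
Proof. by apply: eq_card => g; rewrite !inE loopless_matching. Qed.

Lemma card_agreement i (A : {set 'I_n}) :
  #|[set j | agreement i j == A]| = d ^ (n - #|A|).
Proof.
pose F v := if v \in A then pred1 (i v) else predC1 (i v).
have -> : #|[set j | agreement i j == A]| = #|family F|.
  apply: eq_card => j; rewrite !inE; apply/eqP/familyP => [E v|h].
    by rewrite /F -E inE; case: eqP => [->|/eqP h]; rewrite !inE // eq_sym.
  apply/setP => v; have := h v; rewrite inE /F; case: (v \in A); rewrite !inE eq_sym //.
  by move/negbTE.
rewrite card_family foldrE big_map big_enum /=.
rewrite (bigID (mem A)) /= big1 ?mul1n => [|v vA]; last by rewrite /F vA card1.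
rewrite (eq_bigr (fun=> d)) => [|v vA]; last first.
  by rewrite /F (negbTE vA) cardC1 card_ord.
rewrite prod_nat_const; congr (_ ^ _).
have <- : #|~: A| = n - #|A| by rewrite cardsCs setCK card_ord.
by apply: eq_card => v; rewrite !inE.
Qed.

(** Up to normalization, the agreement of a fixed layer with a uniform one is binomial with
    parameter 1/(d+1). *)
Lemma sum_over_agreement i (R : comPzSemiRingType) (h : nat -> R) :
  (\sum_j h #|agreement i j| = \sum_(a < n.+1) ('C(n, a) * d ^ (n - a))%:R * h a)%R.
Proof.
rewrite (partition_big (agreement i) xpredT) //=.
transitivity (\sum_(A : {set 'I_n}) (d ^ (n - #|A|))%:R * h #|A|)%R.
  apply: eq_bigr => A _; rewrite (eq_bigr (fun=> h #|A|)) => [|j /eqP -> //].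
  by rewrite sumr_const -(card_agreement i) mulr_natl cardsE.
have cA (A : {set 'I_n}) : #|A| < n.+1 by rewrite ltnS -[X in _ <= X](card_ord n) max_card.
rewrite (partition_big (fun A : {set 'I_n} => Ordinal (cA A)) xpredT) //=.
apply: eq_bigr => a _.
rewrite (eq_bigr (fun=> (d ^ (n - a))%:R * h a)%R) => [|A /eqP <- //].
rewrite sumr_const natrM -mulrA [in RHS]mulr_natl; congr (_ *+ _)%R.
have -> : 'C(n, a) = #|[set A : {set 'I_n} | #|A| == a]|.
  by rewrite card_draws card_ord.
by apply: eq_card => A; rewrite [RHS]inE.
Qed.

End Layers.

(** * The superposition and its symmetrization *)

Section Superposition.
Variables (n d : nat).
Notation pt := (point n d.+1).
Notation slots := {ffun 'I_n -> 'I_d.+1}.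
Implicit Types (i j : slots) (g : pairingfun n d.+1) (f : pairingfun n d)
  (m : {ffun 'I_n -> 'I_n}).

Lemma pair_inj (X Y : Type) (a a' : X) (c c' : Y) : (a, c) = (a', c') -> a = a' /\ c = c'.
Proof. by case. Qed.

Definition top : slots := [ffun=> ord_max].

Definition super_support : {set pairingfun n d.+1} :=
  [set g | is_loopless_pairing g && preserves top g].

Lemma superpose_lift f m v s :
  superpose f m (v, lift ord_max s) = ((f (v, s)).1, lift ord_max (f (v, s)).2).
Proof. by rewrite ffunE /= liftK. Qed.

Lemma superpose_top f m v : superpose f m (v, ord_max) = (m v, ord_max).
Proof. by rewrite ffunE /= unlift_none. Qed.

Lemma point_top_ind (P : pt -> Prop) :
  (forall v, P (v, ord_max)) -> (forall v s, P (v, lift ord_max s)) -> forall x, P x.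
Proof. by move=> h1 h2 [v s]; case: (unliftP ord_max s) => [t|] ->. Qed.

Lemma superpose_inj f m f' m' : superpose f m = superpose f' m' -> (f, m) = (f', m').
Proof.
move=> E; congr pair; apply/ffunP => x.
  case: x => v s; have /ffunP/(_ (v, lift ord_max s)) := E.
  rewrite !superpose_lift => E'; have [E1 /lift_inj E2] := pair_inj E'.
  by rewrite [LHS]surjective_pairing E1 E2 -surjective_pairing.
have /ffunP/(_ (x, ord_max)) := E.
by rewrite !superpose_top => E'; have [] := pair_inj E'.
Qed.

Lemma superpose_support f m : is_loopless_pairing f -> is_perfect_matching m ->
  superpose f m \in super_support.
Proof.
move=> /andP[/forallP f1 /forallP f2] /forallP hm; rewrite inE; apply/andP; split.
  apply/andP; split; apply/forallP; apply: point_top_ind => [v|v s].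
  - have /andP[/eqP mm mv] := hm v.
    by rewrite !superpose_top mm eqxx /=; apply: contraNN mv => /eqP[->].
  - have /andP[/eqP ff fv] := f1 (v, s).
    rewrite !superpose_lift /= -surjective_pairing ff eqxx /=.
    apply: contraNN fv => /eqP E; have [E1 /lift_inj E2] := pair_inj E.
    by rewrite [X in X == _]surjective_pairing E1 E2.
  - by have /andP[_] := hm v; rewrite superpose_top.
  - by have := f2 (v, s); rewrite superpose_lift.
apply/forallP; apply: point_top_ind => [v|v s].
  by apply/implyP => _; rewrite superpose_top inE ffunE.
by rewrite !inE ffunE /= eq_sym (negbTE (neq_lift _ _)).
Qed.

Lemma support_superpose g : g \in super_support ->
  exists f m, [/\ is_loopless_pairing f, is_perfect_matching m & superpose f m = g].
Proof.
rewrite inE => /andP[lg /(preservesP _ lg) pg].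
have /andP[/forallP g1 /forallP g2] := lg.
pose m := [ffun v => (g (v, ord_max)).1].
(* The default [x.2] is never reached: [g] preserves the top layer, so it sends no other point into
   it. *)
pose f : pairingfun n d := [ffun x => ((g (x.1, lift ord_max x.2)).1,
  odflt x.2 (unlift ord_max (g (x.1, lift ord_max x.2)).2))].
have gtop v : g (v, ord_max) = (m v, ord_max).
  have := pg (v, ord_max); rewrite !inE !ffunE eqxx => /esym/eqP E.
  by rewrite [LHS]surjective_pairing E.
have glift v s : g (v, lift ord_max s) = ((f (v, s)).1, lift ord_max (f (v, s)).2).
  have := pg (v, lift ord_max s); rewrite !inE !ffunE /= eq_sym (negbTE (neq_lift _ _)).
  case: (unliftP ord_max (g (v, lift ord_max s)).2) => [t E|E]; last by rewrite E eqxx.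
  by rewrite [g _]surjective_pairing E.
exists f, m; split.
- apply/andP; split; apply/forallP => -[v s].
    have := g1 (v, lift ord_max s); rewrite !glift /= -surjective_pairing.
    case/andP => /eqP E; have [E1 /lift_inj E2] := pair_inj E; move=> h; apply/andP; split.
      by rewrite [X in X == _]surjective_pairing E1 E2.
    by apply: contraNN h => /eqP ->.
  by have := g2 (v, lift ord_max s); rewrite glift.
- apply/forallP => v; have := g1 (v, ord_max); rewrite !gtop => /andP[/eqP[->] h].
  by rewrite eqxx; apply: contraNN h => /eqP ->.
apply/ffunP; apply: point_top_ind => [v|v s].
  by rewrite superpose_top gtop.
by rewrite superpose_lift glift.
Qed.

Lemma card_super_support : #|super_support| =
  #|[set f : pairingfun n d | is_loopless_pairing f]| *
  #|[set m : {ffun 'I_n -> 'I_n} | is_perfect_matching m]|.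
Proof.
rewrite -cardsX -(card_in_imset (f := fun p => superpose p.1 p.2)); last first.
  by move=> [f m] [f' m'] _ _ /superpose_inj.
apply: eq_card => g; apply/idP/imsetP => [/support_superpose[f [m [lf pm <-]]]|[[f m]]].
  by exists (f, m); rewrite // !inE lf.
by move=> /setXP[lf pm] ->; apply: superpose_support; [move: lf | move: pm]; rewrite inE.
Qed.

Definition swap i (x : pt) : pt := (x.1, tperm (i x.1) ord_max x.2).

Definition swap_pairing i g : pairingfun n d.+1 := [ffun x => swap i (g (swap i x))].

Lemma swapK i : involutive (swap i).
Proof. by move=> x; rewrite /swap /= tpermK -surjective_pairing. Qed.

Lemma swap_pairingK i : involutive (swap_pairing i).
Proof. by move=> g; apply/ffunP => x; rewrite !ffunE !swapK. Qed.

Lemma multigraph_swap i g : multigraph (swap_pairing i g) = multigraph g.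
Proof.
apply/ffunP => uv; rewrite !ffunE.
rewrite -[RHS](card_imset _ (inv_inj (swapK i))); apply: eq_card => x.
rewrite !inE; apply/idP/imsetP => [|[y + ->]].
  by rewrite ffunE => h; exists (swap i x); rewrite ?swapK // inE.
by rewrite inE ffunE swapK.
Qed.

Lemma swap_loopless i g : is_loopless_pairing (swap_pairing i g) = is_loopless_pairing g.
Proof.
suff imp h : is_loopless_pairing h -> is_loopless_pairing (swap_pairing i h).
  by apply/idP/idP => [/imp|/imp //]; rewrite swap_pairingK.
case/andP => /forallP h1 /forallP h2; apply/andP; split; apply/forallP => x.
  have /andP[/eqP hh hx] := h1 (swap i x).
  rewrite !ffunE swapK hh swapK eqxx /=.
  by apply: contraNN hx => /eqP E; rewrite -[X in _ == swap _ X]E swapK.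
by have := h2 (swap i x); rewrite ffunE.
Qed.

Lemma swap_layer i x : (swap i x \in layer top) = (x \in layer i).
Proof.
by rewrite !inE ffunE /= -[X in _ == X](tpermL (i x.1)) (inj_eq perm_inj).
Qed.

(** Hence averaging the swapped superposition over all [i] charges [g] in proportion to the number
    of layers that it preserves. *)
Lemma swap_support i g :
  (swap_pairing i g \in super_support) = is_loopless_pairing g && preserves i g.
Proof.
rewrite inE swap_loopless; case lg: (is_loopless_pairing g) => //=.
have lg' : is_loopless_pairing (swap_pairing i g) by rewrite swap_loopless.
apply/(preservesP _ lg')/(preservesP _ lg) => h x.
  have := h (swap i x); rewrite !ffunE !swapK -[swap i (g x) \in _]/(swap i (g x) \in layer top).
  by rewrite !swap_layer.
by rewrite ffunE swap_layer -h -(swap_layer i) swapK.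
Qed.

Local Open Scope ring_scope.

(** [superpose] is a bijection from the pairs of a loopless pairing and a perfect matching onto
    [super_support]. *)
Lemma law_superE (R : realType) g :
  law_super R g = if g \in super_support then (#|super_support|%:R)^-1 else 0.
Proof.
have LM f m : is_loopless_pairing f -> is_perfect_matching m ->
    law_Pstar R f * law_M R m = (#|super_support|%:R)^-1.
  move=> lf pm; rewrite /law_Pstar /law_M /unif lf pm card_super_support natrM invfM.
  by rewrite !cardsE.
case: ifP => gQ; last first.
  rewrite /law_super big1 // => f _; rewrite big1 // => m _.
  rewrite /law_Pstar /law_M /unif.
  case: ifP => lf; last by rewrite !mul0r.
  case: ifP => pm; last by rewrite mulr0 mul0r.
  case: eqP => [E|_]; last by rewrite mulr0.
  by rewrite -E superpose_support in gQ.
have [f [m [lf pm E]]] := support_superpose gQ.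
rewrite /law_super pair_bigA /= (bigD1 (f, m)) //= E eqxx mulr1 LM // big1 ?addr0 // => -[f' m'] /= h.
case: eqP => [E'|_]; last by rewrite mulr0.
by move: h; rewrite (superpose_inj (etrans E' (esym E))) eqxx.
Qed.

End Superposition.

Lemma oddfact_gt0 j : 0 < oddfact j.
Proof. by elim: j => //= j IH; rewrite muln_gt0 IH. Qed.

Lemma fact_double j : (2 * j)`! = 2 ^ j * j`! * oddfact j.
Proof.
elim: j => // j IH.
have -> : 2 * j.+1 = (2 * j).+2 by lia.
by rewrite !factS IH expnS /=; ring.
Qed.

(** Both sides count the perfect matchings of 2N points with k marked pairs. *)
Lemma bin_double N k : k <= N ->
  'C(2 * N, 2 * k) * oddfact k * oddfact (N - k) = oddfact N * 'C(N, k).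
Proof.
move=> kN; have h1 := bin_fact kN.
have h2 : 2 * k <= 2 * N by lia.
have := bin_fact h2; rewrite -mulnBr !fact_double -[in RHS]h1 -[in RHS](subnKC kN) expnD subnKC //.
set A := 2 ^ k; set B := 2 ^ (N - k); set F := k`!; set G := (N - k)`!.
have : 0 < A * B * F * G by rewrite !muln_gt0 !expn_gt0 !fact_gt0.
set X := 'C(_, _); set Y := 'C(_, _) => pos h.
apply/eqP; rewrite -(eqn_pmul2l pos); apply/eqP; rewrite -/X -/Y in h *.
transitivity (X * (A * F * oddfact k * (B * G * oddfact (N - k)))); first by ring.
by rewrite h; ring.
Qed.

Local Open Scope ring_scope.

(** * The coupling *)

Section ClassCoupling.
Variables (R : realType) (T : finType) (U : eqType) (phi : T -> U) (p q r : T -> R).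
Hypotheses (p0 : forall x, 0 <= p x) (q0 : forall x, 0 <= q x)
  (p1 : \sum_x p x = 1) (q1 : \sum_x q x = 1)
  (pr : forall x, \sum_(y | phi y == phi x) p y = \sum_(y | phi y == phi x) r y).

Let pc x := \sum_(y | phi y == phi x) p y.
Let qc x := \sum_(y | phi y == phi x) q y.
(** Inside a class, [mu1] is a multiple of the product of [p] and [q], of total mass pc * qc /
    max(pc, qc) = min(pc, qc), the most that the two laws can share there. Its marginals are [a] and
    [b]. *)
Let M x := Num.max (pc x) (qc x).
Let mu1 x y := if phi y == phi x then p x * q y / M x else 0.
Let a x := p x * (qc x / M x).
Let b y := q y * (pc y / M y).

(* [p] and [q] may be far apart pointwise: only the masses of the classes of [phi]
   matter, and these may be computed from any [r] with the same class masses. *)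
Lemma class_coupling : exists mu : T * T -> R, is_coupling p q mu /\
  1 - \sum_y `|r y - q y| <= \sum_(z | phi z.1 == phi z.2) mu z.
Proof.
have pc0 x : 0 <= pc x by apply: sumr_ge0.
have qc0 x : 0 <= qc x by apply: sumr_ge0.
have M0 x : 0 <= M x by rewrite le_max pc0.
have pcM x : pc x / M x <= 1.
  have [->|Mx] := eqVneq (M x) 0; first by rewrite invr0 mulr0.
  by rewrite ler_pdivrMr ?lt_def ?Mx ?M0 // mul1r le_max lexx.
have qcM x : qc x / M x <= 1.
  have [->|Mx] := eqVneq (M x) 0; first by rewrite invr0 mulr0.
  by rewrite ler_pdivrMr ?lt_def ?Mx ?M0 // mul1r le_max lexx orbT.
have cls x y : phi y == phi x -> [/\ pc y = pc x, qc y = qc x & M y = M x].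
  by rewrite /M /pc /qc => /eqP ->.
have a0 x : 0 <= a x by rewrite mulr_ge0 ?divr_ge0.
have b0 x : 0 <= b x by rewrite mulr_ge0 ?divr_ge0.
have ap x : a x <= p x by rewrite ler_piMr.
have bq x : b x <= q x by rewrite ler_piMr.
have suma x : \sum_y mu1 x y = a x.
  rewrite /mu1 -big_mkcond /= /a /qc mulr_suml mulr_sumr.
  by apply: eq_bigr => y _; rewrite mulrA.
have sumb y : \sum_x mu1 x y = b y.
  rewrite /mu1 -big_mkcond /= /b /pc mulr_suml mulr_sumr; apply: eq_big => x.
    by rewrite eq_sym.
  by rewrite eq_sym => /cls[_ _ ->]; rewrite mulrCA mulrA.
have mu10 x y : 0 <= mu1 x y.
  by rewrite /mu1; case: ifP => // _; rewrite divr_ge0 ?mulr_ge0.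
pose dl := 1 - \sum_x a x.
have dla : \sum_x (p x - a x) = dl by rewrite sumrB p1.
have dlb : \sum_x (q x - b x) = dl.
  rewrite sumrB q1 /dl; congr (_ - _).
  under eq_bigr do rewrite -sumb; under [in RHS]eq_bigr do rewrite -suma.
  by rewrite exchange_big.
have dl0 : 0 <= dl by rewrite -dla sumr_ge0 // => x _; rewrite subr_ge0.
(* If [dl] is 0 the quotient is 0 by convention, but then every remainder [p x - a x] vanishes
   too. *)
have resa x : (p x - a x) * dl / dl = p x - a x.
  have [dz|dz] := eqVneq dl 0; last by rewrite mulfK.
  have -> : p x - a x = 0; last by rewrite !mul0r.
  have /eqP := dla; rewrite dz psumr_eq0 => [/allP/(_ x)|y _]; last by rewrite subr_ge0.
  by rewrite mem_index_enum => /(_ isT)/eqP.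
have resb x : (q x - b x) * dl / dl = q x - b x.
  have [dz|dz] := eqVneq dl 0; last by rewrite mulfK.
  have -> : q x - b x = 0; last by rewrite !mul0r.
  have /eqP := dlb; rewrite dz psumr_eq0 => [/allP/(_ x)|y _]; last by rewrite subr_ge0.
  by rewrite mem_index_enum => /(_ isT)/eqP.
(* The two remainders have the same mass [dl] and are joined independently. *)
pose mu (z : T * T) := mu1 z.1 z.2 + (p z.1 - a z.1) * (q z.2 - b z.2) / dl.
have mu2 x y : 0 <= (p x - a x) * (q y - b y) / dl.
  by rewrite divr_ge0 // mulr_ge0 // subr_ge0.
exists mu; split; first (split; [|split]).
- by move=> [x y]; rewrite addr_ge0.
- move=> x; rewrite big_split /= suma -mulr_suml -mulr_sumr dlb resa; ring.
- move=> y; rewrite big_split /= sumb -mulr_suml -mulr_suml dla mulrC.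
  by rewrite [dl * _]mulrC mulrC resb; ring.
have key : \sum_x a x <= \sum_(z | phi z.1 == phi z.2) mu z.
  apply: (@le_trans _ _ (\sum_(z | phi z.1 == phi z.2) mu1 z.1 z.2)).
    have -> : \sum_(z | phi z.1 == phi z.2) mu1 z.1 z.2 =
        \sum_x \sum_y if phi x == phi y then mu1 x y else 0.
      by rewrite pair_bigA big_mkcond.
    apply: ler_sum => x _; rewrite -suma; apply: ler_sum => y _.
    by rewrite /mu1 eq_sym; case: ifP.
  by apply: ler_sum => z _; rewrite lerDl.
apply: le_trans key; rewrite lerBlDr -lerBlDl -/dl -dla.
(* The mass lost at [x] is its share [p x / pc x] of the positive part of [pc x - qc x]. Only class
   masses appear, so [r] can replace [p]. *)
have main x : p x - a x <= \sum_(y | phi y == phi x) p x / pc x * `|r y - q y|.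
  rewrite -mulr_sumr.
  have [pz|pz] := eqVneq (pc x) 0.
    have px : p x = 0.
      have /eqP := pz; rewrite /pc psumr_eq0 => [/allP/(_ x)|y _ //].
      by rewrite mem_index_enum eqxx => /(_ isT)/eqP.
    by rewrite px mul0r mul0r sub0r oppr_le0.
  have pp : 0 < pc x by rewrite lt_def pz pc0.
  have s0 : 0 <= \sum_(y | phi y == phi x) `|r y - q y| by apply: sumr_ge0.
  rewrite /a /M; case: (leP (pc x) (qc x)) => h.
    have qp : 0 < qc x := lt_le_trans pp h.
    by rewrite divff ?gt_eqF // mulr1 subrr mulr_ge0 // divr_ge0.
  have -> : p x - p x * (qc x / pc x) = p x / pc x * (pc x - qc x) by field.
  rewrite ler_wpM2l ?divr_ge0 // {1}/pc pr -sumrB; apply: ler_sum => y _; exact: ler_norm.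
apply: le_trans (ler_sum _ (fun x _ => main x)) _.
rewrite (exchange_big_dep xpredT) //=; apply: ler_sum => y _.
rewrite -mulr_suml ler_piMl //.
rewrite (eq_bigr (fun x => p x / pc y)) => [|x h]; last by have [->] := cls _ _ h.
rewrite -mulr_suml (eq_bigl (fun x => phi x == phi y)) => [|x]; last by rewrite eq_sym.
by rewrite -/(pc y); have [->|h] := eqVneq (pc y) 0; rewrite ?mul0r // divff.
Qed.

End ClassCoupling.

(** * Moments of the number of preserved layers *)

Section SecondMoment.
Variables (R : realType) (n d : nat).
Notation slots := {ffun 'I_n -> 'I_d.+1}.
Notation L := [set g : pairingfun n d.+1 | is_loopless_pairing g].
Notation Q := (super_support n d).
Implicit Types (i j : slots) (g h : pairingfun n d.+1).

Let fits g i : bool := is_loopless_pairing g && preserves i g.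
Let X g : R := \sum_i (fits g i)%:R.
(** Under the uniform law on [L], the mean of [X] is [W / #|L|] and that of its square
    [second_moment / #|L|]; hence the ratio [#|L| * second_moment / W ^+ 2] below. *)
Let W : R := d.+1%:R ^+ n * #|Q|%:R.

Definition second_moment : R :=
  \sum_(i : slots) \sum_(j : slots)
    #|[set g | [&& is_loopless_pairing g, preserves i g & preserves j g]]|%:R.

(** By [swap_pairingK], every layer is preserved by as many loopless pairings as the top one. *)
Lemma sum_fits : \sum_g X g = W.
Proof.
rewrite /X exchange_big /= (eq_bigr (fun=> #|Q|%:R)) => [|i _].
  by rewrite sumr_const card_ffun !card_ord /W -natrX mulr_natl.
rewrite -natr_sum; congr _%:R.
rewrite -(card_imset (mem Q) (inv_inj (@swap_pairingK n d i))) -sum1_card.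
rewrite [RHS]big_mkcond /=; apply: eq_bigr => g _.
have -> : (g \in [set swap_pairing i h | h in mem Q]) = fits g i.
  rewrite /fits -swap_support; apply/imsetP/idP => [[h hQ ->]|h].
    by rewrite swap_pairingK.
  by exists (swap_pairing i g); rewrite ?swap_pairingK.
by case: fits.
Qed.

Lemma sum_fits_sqr : \sum_g X g ^+ 2 = second_moment.
Proof.
rewrite /second_moment.
transitivity (\sum_g \sum_i \sum_j (fits g i && fits g j)%:R : R).
  apply: eq_bigr => g _; rewrite expr2 /X mulr_suml; apply: eq_bigr => i _.
  by rewrite mulr_sumr; apply: eq_bigr => j _; rewrite -natrM mulnb.
rewrite exchange_big /=; apply: eq_bigr => i _.
rewrite exchange_big /=; apply: eq_bigr => j _.
rewrite -natr_sum; congr _%:R; rewrite -sum1_card [RHS]big_mkcond /=.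
apply: eq_bigr => g _; rewrite inE /fits.
by case: is_loopless_pairing => //=; case: (_ && _).
Qed.

Lemma sum_unif (T : finType) (A : pred T) : (0 < #|[pred y | A y]|)%N -> \sum_x unif R A x = 1.
Proof.
move=> h; rewrite /unif -big_mkcond /= sumr_const -(mulr_natr (_^-1)).
by rewrite mulVf // pnatr_eq0 -lt0n.
Qed.

(* [|x| <= (eta u + x^2 / (eta u)) / 2] with [u] the uniform density is summed
   in place of the Cauchy-Schwarz inequality. *)
Lemma coupling_of_second_moment (eta : R) : (0 < #|Q|)%N -> (0 < #|L|)%N -> 0 < eta ->
  exists mu : pairingfun n d.+1 * pairingfun n d.+1 -> R,
    is_coupling (@law_super R n d) (@law_Pstar R n d.+1) mu /\
    1 - (eta + (#|L|%:R * second_moment / W ^+ 2 - 1) / eta) / 2 <=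
      \sum_(z | multigraph z.1 == multigraph z.2) mu z.
Proof.
move=> Q0 L0 eta0.
have W0 : 0 < W by rewrite mulr_gt0 ?exprn_gt0 ?ltr0n.
have LR : 0 < #|L|%:R :> R by rewrite ltr0n.
have QR : 0 < #|Q|%:R :> R by rewrite ltr0n.
pose r g := X g / W.
have rE g : r g = (d.+1%:R ^+ n)^-1 * \sum_i law_super R (swap_pairing i g).
  rewrite /r /W invfM mulrCA; congr (_ * _); rewrite mulr_suml.
  apply: eq_bigr => i _; rewrite law_superE swap_support -/(fits g i).
  by case: fits; rewrite ?mul1r ?mul0r.
have super0 g : 0 <= law_super R g.
  by rewrite law_superE; case: ifP => // _; rewrite invr_ge0.
have star0 g : 0 <= law_Pstar R g.
  by rewrite /law_Pstar /unif; case: ifP => // _; rewrite invr_ge0.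
have super1 : \sum_(g : pairingfun n d.+1) law_super R g = 1 :> R.
  under eq_bigr do rewrite law_superE.
  by rewrite -big_mkcond /= sumr_const -(mulr_natr (_^-1)) mulVf ?gt_eqF.
have star1 : \sum_(g : pairingfun n d.+1) law_Pstar R g = 1 :> R.
  by apply: sum_unif; rewrite -cardsE.
(* Swapping by [i] permutes each class of pairings with a given multigraph, so averaging over [i]
   keeps the class masses. *)
have same g : \sum_(h : pairingfun n d.+1 | multigraph h == multigraph g) law_super R h =
    \sum_(h : pairingfun n d.+1 | multigraph h == multigraph g) r h.
  under [RHS]eq_bigr do rewrite rE.
  set S := LHS; rewrite -mulr_sumr.
  have -> : \sum_(h : pairingfun n d.+1 | multigraph h == multigraph g) \sum_(i : slots) law_super R (swap_pairing i h) =
      \sum_(i : slots) S.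
    rewrite [LHS]exchange_big; apply: eq_bigr => i _.
    rewrite /S [RHS](reindex_inj (inv_inj (@swap_pairingK n d i))) /=.
    by apply: eq_bigl => h; rewrite multigraph_swap.
  rewrite sumr_const card_ffun !card_ord -(mulr_natl S) mulrA natrX mulVf ?mul1r //.
  by rewrite expf_neq0 // pnatr_eq0.
have [mu [cmu hmu]] := class_coupling (phi := @multigraph n d.+1) super0 star0 super1 star1 same.
exists mu; split=> //; apply: le_trans hmu; apply: lerB => //.
pose v : R := #|L|%:R.
have pt g : `|r g - law_Pstar R g| <=
    (eta * law_Pstar R g + (v * r g ^+ 2 - 2 * r g + law_Pstar R g) / eta) / 2.
  rewrite /law_Pstar /unif; case: ifP => lg; last first.
    have -> : r g = 0 by rewrite /r /X big1 ?mul0r // => i _; rewrite /fits lg.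
    by rewrite subrr normr0 expr2; lra.
  rewrite -cardsE -/v; set x := r g.
  have -> : v * x ^+ 2 - 2 * x + v^-1 = v * (x - v^-1) ^+ 2.
    by field; rewrite gt_eqF.
  rewrite ler_pdivlMr // -subr_ge0.
  have -> : eta * v^-1 + v * (x - v^-1) ^+ 2 / eta - `|x - v^-1| * 2 =
     v / eta * (`|x - v^-1| - eta / v) ^+ 2.
    rewrite -(real_normK (num_real (x - v^-1))); field.
    by rewrite !gt_eqF.
  by rewrite mulr_ge0 ?sqr_ge0 // divr_ge0 // ltW.
apply: le_trans (ler_sum _ (fun g _ => pt g)) _.
rewrite -mulr_suml big_split /= -mulr_sumr star1 -mulr_suml big_split /= star1 sumrB.
rewrite -!mulr_sumr mulr1.
have -> : \sum_g r g = 1 by rewrite /r -mulr_suml sum_fits divff ?gt_eqF.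
have -> : \sum_g r g ^+ 2 = second_moment / W ^+ 2.
  by rewrite -sum_fits_sqr mulr_suml; apply: eq_bigr => g _; rewrite /r exprMn exprVn.
rewrite /v mulrA le_eqVlt; apply/orP; left; apply/eqP; ring.
Qed.

End SecondMoment.

(** * Double factorials *)

Section Calculus.
Import functions boolp classical_sets topology normedtype derive set_interval.
Import numFieldNormedType.Exports.
Variable R : realType.

Lemma ge0_of_derive (f df : R -> R) : f 0 = 0 ->
  (forall x : R, is_derive x 1 f (df x)) -> (forall x, 0 <= x -> 0 <= df x) ->
  forall x, 0 <= x -> 0 <= f x.
Proof.
move=> f0 fd df0 x x0.
have cf : {within `[0, x], continuous f}%classic.
  apply: continuous_subspaceT => y.
  apply: differentiable_continuous; apply/derivable1_diffP.
  by have [] := fd y.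
have [c] := MVT_segment x0 (fun y _ => fd y) cf.
by rewrite in_itv /= f0 !subr0 => /andP[c0 _] ->; rewrite mulr_ge0 ?df0.
Qed.

Lemma expR_sinh_ge (t : R) : 0 <= t -> 2 * t <= expR t - expR (- t).
Proof.
move=> t0; rewrite -subr_ge0.
pose f := (expR - (fun x : R => expR (- x)) - (fun x => 2 * x)) : R -> R.
rewrite -[leRHS]/(f t); move: t t0; apply: (@ge0_of_derive f (fun x => expR x + expR (- x) - 2)).
- by rewrite /f /= !fctE oppr0 expR0 mulr0 !subrr.
- by move=> x; rewrite /f; apply: is_derive_eq; rewrite /= [_%:A]mulr1 mulrN1 opprK.
- by move=> x _; have := expR_ge1Dx x; have := expR_ge1Dx (- x); lra.
Qed.

Lemma expR_tanh_le (t : R) : 0 <= t -> 2 * (expR t - 1) <= t * (expR t + 1).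
Proof.
move=> t0; rewrite -subr_ge0.
pose f := (id * (expR + cst 1) - (2 : R) *: (expR - cst 1)) : R -> R.
change (0 <= f t); move: t t0; apply: (@ge0_of_derive f (fun x => 1 + (x - 1) * expR x)).
- by rewrite /f /= !fctE mul0r expR0 subrr scaler0 subrr.
- move=> x; rewrite /f; apply: is_derive_eq => /=.
  rewrite !fctE. rewrite /GRing.scale /=; ring.
move=> x x0; have := expR_ge1Dx (- x).
have := expR_gt0 x; have := expRxMexpNx_1 x; nra.
Qed.
End Calculus.

Section LnBounds.
Variable R : realType.

(* With [t = ln (1 + x)] these are [t <= sinh t] and [tanh (t / 2) <= t / 2]. *)

Lemma ln1D_le (x : R) : 0 <= x -> ln (1 + x) <= (x + x / (1 + x)) / 2.
Proof.
move=> x0; have x1 : 0 < 1 + x by lra.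
have := expR_sinh_ge (ln_ge0 (_ : 1 <= 1 + x)); rewrite expRN lnK ?posrE // => /(_ _).
have -> : x / (1 + x) = 1 - (1 + x)^-1 by field; lra.
by move=> /(_ ltac:(lra)); lra.
Qed.

Lemma ln1D_ge (x : R) : 0 <= x -> 2 * x / (2 + x) <= ln (1 + x).
Proof.
move=> x0; have x1 : 0 < 1 + x by lra.
have := expR_tanh_le (ln_ge0 (_ : 1 <= 1 + x)); rewrite lnK ?posrE // => /(_ _).
move=> /(_ ltac:(lra)) h; rewrite ler_pdivrMr; lra.
Qed.

End LnBounds.

(** * Central binomial coefficients *)

Section Wallis.
Variable R : realType.

(* [C(2 j, j) / 4 ^ j] *)
Definition central (j : nat) : R := (oddfact j)%:R / (2 ^+ j * (j`!)%:R).

Lemma central_den (j : nat) : 0 < 2 ^+ j * (j`!)%:R :> R.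
Proof. by rewrite mulr_gt0 ?exprn_gt0 ?ltr0n ?fact_gt0. Qed.

Lemma centralS j : central j.+1 = central j * ((2 * j%:R + 1) / (2 * j%:R + 2)).
Proof.
rewrite /central /= factS exprS !natrM -(natr1 j) -(natr1 (2 * j)) natrM.
have f0 : (j`!)%:R != 0 :> R by rewrite pnatr_eq0 -lt0n fact_gt0.
set a := _ ^+ j; have a0 : a != 0 by rewrite expf_neq0 ?pnatr_eq0.
have j0 : 0 <= j%:R :> R by [].
move: a a0 => a a0.
have p1 : 2 * j%:R + 2 != 0 :> R by lra.
have p2 : j%:R + 1 != 0 :> R by lra.
by field; rewrite p1 p2 f0 a0.
Qed.

Lemma central0 : central 0 = 1.
Proof. by rewrite /central fact0 expr0 mulr1 divr1. Qed.

Lemma central_gt0 j : 0 < central j.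
Proof. by rewrite divr_gt0 ?central_den // ltr0n oddfact_gt0. Qed.

Lemma central_le1 j : central j <= 1.
Proof.
elim: j => [|j IH]; first by rewrite central0.
rewrite centralS; apply: mulr_ile1 => //; rewrite ?(ltW (central_gt0 _)) //.
  by rewrite divr_ge0 // ?addr_ge0 // mulr_ge0.
have j0 : 0 <= j%:R :> R by [].
rewrite ler_pdivrMr; lra.
Qed.

Lemma central_ge j : 1 <= 2 * j.+1%:R * central j.+1.
Proof.
elim: j => [|j IH].
  by rewrite centralS central0 mul1r mulr0 add0r add0r; lra.
apply: le_trans IH _; rewrite [in leRHS]centralS -(natr1 j.+1).
have x0 : 0 <= j.+1%:R :> R by [].
have := central_gt0 j.+1; set c := central j.+1; move: (j.+1%:R) x0 => x x0 c0.
have p : 2 * x + 2 != 0 by lra.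
have -> : 2 * (x + 1) * (c * ((2 * x + 1) / (2 * x + 2))) = c * (2 * x + 1) by field.
by rewrite mulrC ler_pM2l //; lra.
Qed.

(** Consecutive values have ratio (2j+1)^2 / (4j(j+1)) > 1 for j > 0. This monotone form of Wallis's
    product bounds ratios of [central] by square roots. *)
Lemma central_sqr_homo j N : (j <= N)%N -> central j ^+ 2 * j%:R <= central N ^+ 2 * N%:R.
Proof.
move=> /subnKC <-; elim: (N - j)%N => [|i IH]; first by rewrite addn0.
apply: (le_trans IH); rewrite addnS centralS [X in _ <= X * _]exprMn -[leRHS]mulrA ler_wpM2l ?sqr_ge0 // -(natr1 (j + i)).
have x0 : 0 <= (j + i)%:R :> R by [].
move: (_%:R) x0 => x x0.
have -> : ((2 * x + 1) / (2 * x + 2)) ^+ 2 * (x + 1) = (2 * x + 1) ^+ 2 / (4 * (x + 1)).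
  by field; lra.
rewrite ler_pdivlMr; nra.
Qed.

(** By [central_sqr_homo] the ratio is at most (1 - x)^(-1/2) with x = k/N, and the polynomial
    dominates this for x <= 1/2. *)
Lemma central_ratio_le k N : (2 * k <= N)%N -> (0 < N)%N ->
  central (N - k) / central N <= 1 + k%:R / N%:R / 2 + (k%:R / N%:R) ^+ 2.
Proof.
move=> kN N0; have Nk : (N - k <= N)%N by exact: leq_subr.
have NR : 0 < N%:R :> R by rewrite ltr0n.
set x := k%:R / N%:R.
have x0 : 0 <= x by rewrite divr_ge0.
have x1 : x <= 1 / 2.
  by rewrite ler_pdivrMr // mulrAC mul1r ler_pdivlMr // -natrM ler_nat mulnC.
have kE : (N - k)%:R = N%:R * (1 - x) :> R.
  rewrite natrB; last by lia.
  by rewrite /x; field; rewrite gt_eqF.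
have := central_sqr_homo Nk; rewrite kE.
rewrite ler_pdivrMr ?central_gt0 //.
have := central_gt0 (N - k); have := central_gt0 N.
move: (central N) (central (N - k)) => a b a0 b0 h.
have y0 : 0 <= 1 + x / 2 + x ^+ 2 by nra.
rewrite -ler_sqr ?nnegrE ?(ltW b0) //; last by rewrite mulr_ge0 // ltW.
have h' : b ^+ 2 * (1 - x) <= a ^+ 2.
  by rewrite -(ler_pM2r NR); apply: le_trans h; rewrite -mulrA [_ * N%:R]mulrC.
have hy : 1 <= (1 - x) * (1 + x / 2 + x ^+ 2) ^+ 2.
  have -> : (1 - x) * (1 + x / 2 + x ^+ 2) ^+ 2 = 1 + x ^+ 2 * (5 / 4 * (1 - x) - x ^+ 3) by field.
  rewrite lerDl mulr_ge0 ?sqr_ge0 //.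
  have : x ^+ 3 <= x / 4 by rewrite exprS expr2; nra.
  lra.
move: y0 hy; set y := 1 + x / 2 + x ^+ 2 => y0 hy.
have := ler_wpM2r (sqr_ge0 y) h'; have := ler_wpM2l (sqr_ge0 b) hy.
by clearbody y => h1 h2; lra.
Qed.

End Wallis.

(** * Partial sums of the negative binomial series *)

Section NegativeBinomial.
Variable R : realType.
Implicit Types (c q : R).

Definition rising c k : R := \prod_(i < k) (c + i%:R).
Definition nbterm c q k : R := q ^+ k * rising c k / (k`!)%:R.
Definition nbsum c q M : R := \sum_(k < M) nbterm c q k.

Lemma risingS c k : rising c k.+1 = rising c k * (c + k%:R).
Proof. by rewrite /rising big_ord_recr. Qed.

Lemma rising_recl c k : rising c k.+1 = c * rising (c + 1) k.
Proof.
rewrite /rising big_ord_recl addr0; congr (_ * _); apply: eq_bigr => i _.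
by rewrite /= -natr1 addrA addrAC.
Qed.

Lemma rising_ge0 c k : 0 <= c -> 0 <= rising c k.
Proof. by move=> c0; apply: prodr_ge0 => i _; rewrite addr_ge0. Qed.

Lemma nbterm_ge0 c q k : 0 <= c -> 0 <= q -> 0 <= nbterm c q k.
Proof. by move=> c0 q0; rewrite divr_ge0 // mulr_ge0 ?exprn_ge0 ?rising_ge0. Qed.

Lemma nbsum_ge0 c q M : 0 <= c -> 0 <= q -> 0 <= nbsum c q M.
Proof. by move=> c0 q0; apply: sumr_ge0 => i _; exact: nbterm_ge0. Qed.

Lemma fact_neq0 k : (k`!)%:R != 0 :> R.
Proof. by rewrite pnatr_eq0 -lt0n fact_gt0. Qed.

Lemma nbterm_shift c q k : k.+1%:R * nbterm c q k.+1 = q * c * nbterm (c + 1) q k.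
Proof.
rewrite /nbterm rising_recl factS natrM exprS -(natr1 k).
have := fact_neq0 k; set f := k`!%:R => f0.
have k0 : 0 <= k%:R :> R by [].
have k1 : k%:R + 1 != 0 :> R by lra.
by field; rewrite f0 k1.
Qed.

(* Since [(1 - q) ^ c * nbterm c q k] is the negative binomial law, [nbsum] should
   be at most [(1 - q) ^ - c]; this recurrence gives it, up to a factor, without
   infinite series. *)
Lemma nbterm_pascal c q k :
  nbterm (c + 1) q k.+1 = nbterm c q k.+1 + q * nbterm (c + 1) q k.
Proof.
rewrite /nbterm risingS rising_recl factS natrM exprS -(natr1 k).
have := fact_neq0 k; set f := k`!%:R => f0.
have k0 : 0 <= k%:R :> R by [].
have k1 : k%:R + 1 != 0 :> R by lra.
by field; rewrite f0 k1.
Qed.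

Lemma nbsum_pascal c q M : nbsum (c + 1) q M.+1 = nbsum c q M.+1 + q * nbsum (c + 1) q M.
Proof.
rewrite /nbsum big_ord_recl [in RHS]big_ord_recl /= -addrA; congr (_ + _).
  by rewrite /nbterm /rising !big_ord0.
rewrite mulr_sumr -big_split /=; apply: eq_bigr => i _; exact: nbterm_pascal.
Qed.

Lemma nbsum_le_succ c q M : 0 <= c -> 0 <= q -> nbsum c q M <= nbsum c q M.+1.
Proof. by move=> c0 q0; rewrite /nbsum big_ord_recr lerDl nbterm_ge0. Qed.

Lemma nbsum_step c q M : 0 <= c -> 0 <= q -> (1 - q) * nbsum (c + 1) q M <= nbsum c q M.
Proof.
move=> c0 q0; case: M => [|M]; first by rewrite /nbsum !big_ord0 mulr0.
have c1 : 0 <= c + 1 by lra.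
have := nbsum_pascal c q M; have := nbsum_le_succ M c1 q0.
move: (nbsum (c + 1) q M.+1) (nbsum c q M.+1) (nbsum (c + 1) q M) => x y z; nra.
Qed.

Lemma nbsum_half q M : 0 <= q < 1 -> (1 - q) * nbsum (1 / 2) q M <= 1.
Proof.
case/andP => q0 q1.
apply: (@le_trans _ _ ((1 - q) * \sum_(k < M) q ^+ k)).
  apply: ler_wpM2l; first by lra.
  apply: ler_sum => k _; rewrite /nbterm -mulrA ler_piMr ?exprn_ge0 //.
  rewrite ler_pdivrMr ?ltr0n ?fact_gt0 // [leRHS]mul1r.
  elim: (k : nat) => [|j IH]; first by rewrite /rising big_ord0 fact0.
  have j0 : 0 <= j%:R :> R by [].
  rewrite risingS factS natrM mulrC -(natr1 j).
  by apply: ler_pM => //; [lra | apply: rising_ge0; lra | lra].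
rewrite -opprB mulNr -subrX1 opprB gerBl exprn_ge0 //.
Qed.

(** The full series sums to the power -(m + 1/2). Bounding the base case c = 1/2 by a geometric
    series loses a factor (1 - q)^(-1/2), which is 1 + O(1/d^2) for the q = 1/d^2 used below. *)
Lemma nbsum_le (m : nat) q M : 0 <= q < 1 -> nbsum (m%:R + 1 / 2) q M <= (1 - q) ^- m.+1.
Proof.
case/andP => q0 q1; have p0 : 0 < 1 - q by lra.
elim: m => [|m IH].
  by rewrite add0r expr1 -[leRHS]mul1r ler_pdivlMr // mulrC nbsum_half // q0.
have -> : m.+1%:R + 1 / 2 = m%:R + 1 / 2 + 1 :> R by rewrite -natr1 addrAC.
rewrite exprS invfM [leRHS]mulrC ler_pdivlMr // [leLHS]mulrC.
by apply: le_trans IH; apply: nbsum_step => //; rewrite addr_ge0 ?divr_ge0.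
Qed.

(** Origin of the half-integer parameter of [nbterm]. *)
Lemma oddfact_rising (m k : nat) :
  (oddfact (m + k))%:R = (oddfact m)%:R * (2 ^+ k * rising (m%:R + 1 / 2) k) :> R.
Proof.
elim: k => [|k IH]; first by rewrite addn0 /rising big_ord0 expr0 !mulr1.
rewrite addnS /= natrM IH risingS exprS -(natr1 (2 * _)) natrM natrD; by field.
Qed.

End NegativeBinomial.

(** * Stirling estimates for double factorials *)

Section Stirling.
Variable R : realType.

(* Tends to [ln 2 / 2] by Stirling's formula, but only its increments are needed. *)
Definition stirling (M : nat) : R :=
  ln (oddfact M)%:R + M%:R - M%:R * ln (2 * M%:R).

Lemma stirling_step M : (0 < M)%N ->
  `|stirling M.+1 - stirling M| <= (4 * M%:R ^+ 2)^-1.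
Proof.
move=> M0; have m0 : 1 <= M%:R :> R by rewrite (ler_nat _ 1).
have of0 : 0 < (oddfact M)%:R :> R by rewrite ltr0n oddfact_gt0.
rewrite /stirling /= natrM -(natr1 (2 * M)) natrM -(natr1 M).
move: (M%:R) m0 => m m0; rewrite lnM ?posrE //; last by lra.
set v := ln (oddfact M)%:R.
have h1 := @ln1D_le R m^-1; have h2 := @ln1D_ge R m^-1.
have h3 := @le_ln1Dx R (- (2 * m + 2)^-1); have h4 := @le_ln1Dx R ((2 * m + 1)^-1).
have p1 : 0 < m^-1 by rewrite invr_gt0; lra.
have p2 : 0 < (2 * m + 2)^-1 by rewrite invr_gt0; lra.
have p3 : 0 < (2 * m + 1)^-1 by rewrite invr_gt0; lra.
have e1 : 1 + m^-1 = (2 * (m + 1)) / (2 * m) by field; lra.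
have e3 : 1 - (2 * m + 2)^-1 = (2 * m + 1) / (2 * (m + 1)) by field; lra.
have e4 : 1 + (2 * m + 1)^-1 = (2 * (m + 1)) / (2 * m + 1) by field; lra.
have q2 : (2 * m + 2)^-1 <= 1 / 2 by rewrite -div1r ler_pdivrMr; lra.
move: h1 h2 h3 h4; rewrite e1 e3 e4 !ln_div ?posrE; try lra.
set A := ln (2 * (m + 1)); set B := ln (2 * m); set C := ln (2 * m + 1).
move=> /(_ (ltW p1)) h1 /(_ (ltW p1)) h2 /(_ ltac:(lra)) h3 /(_ ltac:(lra)) h4.
have {}h1 : m * (A - B) <= 1 - (2 * m + 2)^-1.
  have -> : 1 - (2 * m + 2)^-1 = m * ((m^-1 + m^-1 / (2 * (m + 1) / (2 * m))) / 2).
    by field; lra.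
  by rewrite ler_wpM2l //; lra.
have {}h2 : 1 - (2 * m + 1)^-1 <= m * (A - B).
  have -> : 1 - (2 * m + 1)^-1 = m * (2 * m^-1 / (2 + m^-1)).
    field; lra.
  by rewrite ler_wpM2l //; lra.
(* The increment is the difference of [1 - m * (A - B)] and [A - C], which both lie between
   (2m+2)^-1 and (2m+1)^-1. *)
have gap : (2 * m + 1)^-1 - (2 * m + 2)^-1 <= (4 * m ^+ 2)^-1.
  have -> : (2 * m + 1)^-1 - (2 * m + 2)^-1 = ((2 * m + 1) * (2 * m + 2))^-1 by field; lra.
  by rewrite lef_pV2 ?posrE; nra.
have -> : C + v + (m + 1) - (m + 1) * A - (v + m - m * B) = 1 + (C - A) - m * (A - B) by ring.
by rewrite ler_norml; apply/andP; split; lra.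
Qed.

Lemma stirling_range M i : (0 < M)%N ->
  `|stirling (M + i) - stirling M| <= i%:R / (4 * M%:R ^+ 2).
Proof.
move=> M0; elim: i => [|i IH]; first by rewrite addn0 subrr normr0 mul0r.
rewrite addnS; have := @stirling_step (M + i) ltac:(lia).
have m0 : 0 < M%:R :> R by rewrite ltr0n.
have le : (4 * (M + i)%:R ^+ 2)^-1 <= (4 * M%:R ^+ 2)^-1 :> R.
  rewrite lef_pV2 ?posrE ?mulr_gt0 ?exprn_gt0 ?ltr0n ?ler_pM2l //; try lia.
  by rewrite ler_sqr ?nnegrE // ler_nat leq_addr.
move=> h; rewrite -(natr1 i) [leRHS]mulrDl [X in _ <= _ + X]mul1r.
have -> : stirling (M + i).+1 - stirling M =
    (stirling (M + i) - stirling M) + (stirling (M + i).+1 - stirling (M + i)) by ring.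
by apply: le_trans (ler_normD _ _) _; apply: lerD => //; apply: le_trans h le.
Qed.

Lemma stirling_error (x y : R) : 1 <= x -> 1 <= y -> x / (4 * (x * y) ^+ 2) <= (2 * x)^-1.
Proof.
move=> x1 y1; have -> : x / (4 * (x * y) ^+ 2) = (2 * x)^-1 * (2 * y ^+ 2)^-1 by field; lra.
by rewrite ler_piMr ?invr_ge0 //; [lra | rewrite invf_le1; nra].
Qed.

(** A second difference of [ln (oddfact M)] in steps of N around M = N d: the linear terms and those
    in ln (2N) cancel, and two Stirling errors of at most 1/(2N) remain. *)
Lemma oddfact_ratio_le N d : (0 < N)%N -> (1 < d)%N ->
  (oddfact (N * d.+1))%:R * (oddfact (N * d.-1))%:R * d%:R ^+ (2 * (N * d)) <=
  expR (N%:R^-1) * (oddfact (N * d))%:R ^+ 2 *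
    (d.+1%:R ^+ (N * d.+1) * d.-1%:R ^+ (N * d.-1)) :> R.
Proof.
move=> N0 d1.
have s1 : `|stirling (N * d.+1) - stirling (N * d)| <= (2 * N%:R)^-1.
  have -> : (N * d.+1 = N * d + N)%N by lia.
  apply: le_trans (stirling_range _ _) _; first by rewrite muln_gt0 N0; lia.
  by rewrite natrM stirling_error // (ler_nat _ 1) //; lia.
have s2 : `|stirling (N * d) - stirling (N * d.-1)| <= (2 * N%:R)^-1.
  have -> : (N * d = N * d.-1 + N)%N by nia.
  apply: le_trans (stirling_range _ _) _; first by rewrite muln_gt0 N0; lia.
  by rewrite natrM stirling_error // (ler_nat _ 1) //; lia.
have of0 M : 0 < (oddfact M)%:R :> R by rewrite ltr0n oddfact_gt0.
have d0 : 0 < d%:R :> R by rewrite ltr0n; lia.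
have D0 : 0 < d.+1%:R :> R by rewrite ltr0n.
have e0 : 0 < d.-1%:R :> R by rewrite ltr0n; lia.
have NR : 0 < N%:R :> R by rewrite ltr0n.
rewrite -ler_ln ?posrE ?mulr_gt0 ?exprn_gt0 ?mulr_gt0 ?expR_gt0 //.
rewrite !lnM ?posrE ?mulr_gt0 ?exprn_gt0 ?mulr_gt0 ?expR_gt0 // expRK !lnXn //.
move: s1 s2; rewrite !ler_norml /stirling => /andP[_ s1] /andP[s2 _].
move: s1 s2; rewrite !natrM !lnM ?posrE ?mulr_gt0 //.
rewrite -![ln _ *+ _]mulr_natl !natrM.
have -> : (2 * N%:R)^-1 = N%:R^-1 / 2 :> R by rewrite invfM mulrC.
have -> : d.+1%:R = d%:R + 1 :> R by rewrite -(natr1 d).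
have -> : d.-1%:R = d%:R - 1 :> R by rewrite -subn1 natrB //; lia.
move: (ln (d%:R + 1)) (ln (d%:R - 1)) (ln d%:R) (ln N%:R) (ln 2) => a b c u w.
move: (ln _) (ln _) (ln _) => x y z s1 s2.
set n' := N%:R in s1 s2 *; set d' := d%:R in s1 s2 *; lra.
Qed.

End Stirling.

(** * The sum over the overlap of two matchings *)

Section WeightedSum.
Variable R : realType.

Definition weight (N k : nat) : R :=
  central R (N - k) / central R N * expR (- (k%:R / N%:R / 2)).

(* [central (N - k) / central N] is about [(1 - x) ^ (- 1 / 2)] with [x = k / N], so
   the first order terms cancel: this is where loops are better forbidden. The last
   term is a Chernoff weight, which takes care of [k > N / 2]. *)
Lemma weight_le N k : (0 < N)%N -> (k <= N)%N ->
  weight N k <= 1 + (k%:R / N%:R) ^+ 2 + 2 * N%:R * (4 ^+ k / 2 ^+ N).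
Proof.
move=> N0 kN; rewrite /weight; set x := k%:R / N%:R.
have x0 : 0 <= x by rewrite divr_ge0.
have NR : 0 < N%:R :> R by rewrite ltr0n.
have c0 j := central_gt0 R j.
have r0 : 0 <= central R (N - k) / central R N by rewrite divr_ge0 // ltW.
have e0 := expR_ge0 (- (x / 2)).
have t0 : 0 <= 2 * N%:R * (4 ^+ k / 2 ^+ N) :> R.
  by rewrite !mulr_ge0 ?invr_ge0 ?exprn_ge0.
case: (leqP (2 * k) N) => h.
  have h1 := central_ratio_le R h N0; rewrite -/x in h1.
  have y0 : 0 < 1 + x / 2 by lra.
  have h2 : expR (- (x / 2)) <= (1 + x / 2)^-1.
    by rewrite expRN lef_pV2 ?posrE ?expR_gt0 // expR_ge1Dx.
  apply: (@le_trans _ _ ((1 + x / 2 + x ^+ 2) / (1 + x / 2))); first exact: ler_pM.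
  apply: (@le_trans _ _ (1 + x ^+ 2)); last by rewrite lerDl.
  by have x3 := exprn_ge0 3 x0; rewrite ler_pdivrMr //; lra.
have N1 : 1 <= 2 * N%:R * central R N by case: N N0 {kN x x0 NR r0 e0 t0 h} => // N _; exact: central_ge.
have h1 : central R (N - k) / central R N <= 2 * N%:R.
  by rewrite ler_pdivrMr //; apply: le_trans N1; exact: central_le1.
have h2 : expR (- (x / 2)) <= 1 by rewrite expR_le1 oppr_le0 divr_ge0.
have h3 : 1 <= 4 ^+ k / 2 ^+ N :> R.
  have -> : (4 : R) = 2 ^+ 2 by rewrite expr2; ring.
  rewrite -exprM ler_pdivlMr ?exprn_gt0 // mul1r ler_weXn2l //; first by lra.
  exact: ltnW.
apply: (@le_trans _ _ (2 * N%:R * 1)); first by apply: ler_pM.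
apply: (@le_trans _ _ (2 * N%:R * (4 ^+ k / 2 ^+ N))); first by rewrite ler_wpM2l // mulr_ge0.
by rewrite lerDr addr_ge0 // sqr_ge0.
Qed.

(** Absorbs the Chernoff weight of [weight_le] into the parameter. *)
Lemma nbterm_scale c q k : 4 ^+ k * nbterm c q k = nbterm c (4 * q) k :> R.
Proof. by rewrite /nbterm exprMn !mulrA. Qed.

Lemma nbsum_first (c q : R) M (f : nat -> R) :
  \sum_(k < M.+1) k%:R * f k * nbterm c q k =
  q * c * \sum_(k < M) f k.+1 * nbterm (c + 1) q k.
Proof.
rewrite big_ord_recl !mul0r add0r mulr_sumr; apply: eq_bigr => k _.
by rewrite /= mulrAC nbterm_shift; ring.
Qed.

Lemma nbsum_second_moment (c q : R) M :
  \sum_(k < M.+2) k%:R ^+ 2 * nbterm c q k =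
  q * c * (q * (c + 1) * nbsum (c + 1 + 1) q M + nbsum (c + 1) q M.+1).
Proof.
under eq_bigr do rewrite expr2.
rewrite (nbsum_first c q M.+1 (fun k => k%:R)); congr (_ * _).
under eq_bigr do rewrite -natr1 mulrDl mul1r.
rewrite big_split /=; congr (_ + _).
rewrite (eq_bigr (fun k : 'I_M.+1 => k%:R * 1 * nbterm (c + 1) q k)) => [|k _]; last first.
  by rewrite mulr1.
rewrite (nbsum_first (c + 1) q M (fun=> 1)); congr (_ * _).
by apply: eq_bigr => k _; rewrite mul1r.
Qed.

(** The constant is 2 + 4 + 128, from the three terms of [weight_le]. The middle one is small
    because k is about N/d under the negative binomial law, so that (k/N)^2 is of order q. *)
Lemma weighted_nbsum_le (N d : nat) (q := d%:R ^- 2 : R) : (16 <= d)%N -> (d ^ 2 <= N)%N ->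
  \sum_(k < N.+1) nbterm ((N * d.-1)%:R + 1 / 2) q k * weight N k <=
  (1 - q) ^- (N * d.-1) * (1 + 134 * q).
Proof.
move=> d16 dN.
have N0 : (0 < N)%N by nia.
have NR : 0 < N%:R :> R by rewrite ltr0n.
have N256 : 256 <= N%:R :> R by rewrite (ler_nat _ 256); nia.
have dR : 16 <= d%:R :> R by rewrite (ler_nat _ 16).
have d0 : 0 < d%:R :> R by lra.
have dNR : d%:R ^+ 2 <= N%:R :> R by rewrite -natrX ler_nat.
have q0 : 0 < q by rewrite invr_gt0 exprn_gt0.
have qd : q * d%:R ^+ 2 = 1 by rewrite mulVf // expf_neq0 // gt_eqF.
have q1 : 256 * q <= 1.
  by rewrite -[leRHS]qd mulrC ler_wpM2l ?(ltW q0) //; nra.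
set c0 := (N * d.-1)%N; set c := c0%:R + 1 / 2.
have c0E : c0%:R = N%:R * (d%:R - 1) :> R.
  by rewrite /c0 natrM -subn1 natrB //; lia.
have c00 : 0 <= c0%:R :> R by [].
have cge : 0 <= c by rewrite /c; lra.
set y := (1 - q) ^- c0.
have p0 : 0 < 1 - q by lra.
have y0 : 0 < y by rewrite invr_gt0 exprn_gt0.
pose i1 := (1 - q)^-1.
have i1p : 0 < i1 by rewrite invr_gt0.
have i1E : i1 * (1 - q) = 1 by rewrite mulVf // gt_eqF.
have i1le : i1 <= 1 + 2 * q.
  by rewrite -[i1]mulr1 mulrC ler_pdivrMr //; nra.
have i1sq : i1 ^+ 3 <= 2.
  have : i1 <= 1 + 1 / 128 by lra.
  move=> h; have : i1 ^+ 3 <= (1 + 1 / 128) ^+ 3 by rewrite lerXn2r ?nnegrE //; lra.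
  by move/le_trans; apply; lra.
have i1one : 1 <= i1 by rewrite /i1 -div1r ler_pdivlMr //; lra.
have U1 M : nbsum c q M <= y * i1.
  have -> : y * i1 = (1 - q) ^- c0.+1 by rewrite exprSr invfM.
  by apply: nbsum_le; rewrite ltW //=; lra.
have U2 M : nbsum (c + 1) q M <= 2 * y.
  have -> : c + 1 = c0.+1%:R + 1 / 2 by rewrite /c -(natr1 c0) addrAC.
  apply: le_trans (nbsum_le _ _ _) _; first by rewrite ltW //=; lra.
  have -> : (1 - q) ^- c0.+2 = y * (i1 * i1) by rewrite !exprSr !invfM -mulrA.
  rewrite mulrC ler_pM2r //; apply: le_trans i1sq.
  by rewrite !exprS expr0; nra.
have U3 M : nbsum (c + 1 + 1) q M <= 2 * y.
  have -> : c + 1 + 1 = c0.+2%:R + 1 / 2 by rewrite /c -(natr1 c0.+1) -(natr1 c0); ring.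
  apply: le_trans (nbsum_le _ _ _) _; first by rewrite ltW //=; lra.
  have -> : (1 - q) ^- c0.+3 = y * i1 ^+ 3.
    by rewrite !exprSr !invfM expr0 mul1r !mulrA.
  by rewrite mulrC ler_pM2r.
have NdE : N%:R / d%:R = q * (N%:R * d%:R).
  by rewrite -[LHS]mulr1 -[X in _ * X = _]qd; field; rewrite gt_eqF.
have qc1 : q * (c + 1) <= N%:R / d%:R.
  rewrite NdE.
  by rewrite ler_pM2l // /c c0E; lra.
have second : \sum_(k < N.+1) k%:R ^+ 2 * nbterm c q k <= 4 * y * q * N%:R ^+ 2.
  case: N N0 NR N256 dNR @c0 @c c0E c00 cge @y y0 U1 U2 U3 NdE qc1 {dN}
    => // N _ NR N256 dNR c0 c c0E c00 cge y y0 U1 U2 U3 _ qc1.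
  rewrite nbsum_second_moment; set u := N.+1%:R in NR N256 dNR c0E qc1 *.
  set z := u / d%:R in qc1.
  have z1 : q * c <= z by lra.
  have zE : z ^+ 2 = q * u ^+ 2 by rewrite /z /q; field; rewrite gt_eqF.
  have z2 : z <= q * u ^+ 2.
    have -> : q * u ^+ 2 = z * z by rewrite -zE.
    rewrite ler_peMr //; first by rewrite divr_ge0 // ltW.
    by rewrite ler_pdivlMr //; nra.
  apply: (@le_trans _ _ (z * (z * (2 * y) + 2 * y))).
    apply: ler_pM => //.
    - by rewrite mulr_ge0 // ltW.
    - by rewrite addr_ge0 ?mulr_ge0 ?nbsum_ge0 //; lra.
    by rewrite lerD // ler_pM ?nbsum_ge0 ?mulr_ge0 //; lra.
  have -> : z * (z * (2 * y) + 2 * y) = 2 * y * (z ^+ 2 + z) by ring.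
  have -> : 4 * y * q * u ^+ 2 = 2 * y * (2 * (q * u ^+ 2)) by ring.
  by rewrite ler_pM2l; lra.
have half4 : 1 / 2 <= 1 - 4 * q by lra.
(* Passing from q to 4q costs at most a factor about exp(4 q c0) <= exp(N/4), since q c0 <= N/d <=
   N/16. The weight 2^(-N) <= exp(-N/2) outweighs it. *)
have tail : nbsum c (4 * q) N.+1 <= 2 * y * expR (N%:R / 4).
  apply: le_trans (nbsum_le _ _ _) _; first by lra.
  rewrite exprSr invfM mulrC -mulrA; apply: ler_pM; rewrite ?invr_ge0 ?exprn_ge0 //; try lra.
    by rewrite -div1r ler_pdivrMr; lra.
  have -> : (1 - 4 * q) ^- c0 = y * ((1 - q) / (1 - 4 * q)) ^+ c0.
    rewrite exprMn exprVn mulrA mulVf ?mul1r //.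
    by rewrite expf_neq0 // gt_eqF.
  rewrite ler_pM2l //.
  apply: (@le_trans _ _ (expR (4 * q) ^+ c0)).
    rewrite lerXn2r ?nnegrE ?expR_ge0 ?divr_ge0 //; try lra.
    apply: le_trans (expR_ge1Dx _); rewrite ler_pdivrMr; nra.
  rewrite -expRM_natl ler_expR c0E.
  have : q * (N%:R * d%:R) <= N%:R / 16.
    rewrite -NdE.
    by rewrite ler_pM2l // lef_pV2 ?posrE.
  have : 0 <= q * N%:R by rewrite mulr_ge0 // ltW.
  nra.
have pow2 : expR (N%:R / 2) <= 2 ^+ N :> R.
  have -> : N%:R / 2 = N%:R * (1 / 2) :> R by field.
  rewrite expRM_natl lerXn2r ?nnegrE ?expR_ge0 //.
  have := expR_ge1Dx (- (1 / 2) : R); rewrite expRN => h.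
  rewrite -[leLHS]invrK -[leRHS]invrK lef_pV2 ?posrE ?invr_gt0 ?expR_gt0 //; lra.
have decay : N%:R ^+ 2 / 32 <= expR (N%:R / 4) :> R.
  have := @expR_ge1Dxn R (N%:R / 4) 1 ltac:(rewrite divr_ge0 //).
  have -> : (N%:R / 4) ^+ 2 / 2`!%:R = N%:R ^+ 2 / 32 :> R.
    by have -> : (2`!)%:R = 2 :> R by []; field.
  by lra.
have third : 2 * N%:R / 2 ^+ N * nbsum c (4 * q) N.+1 <= 128 * y * q.
  set E := expR (N%:R / 4) in tail decay.
  have E0 : 0 < E by apply: expR_gt0.
  have pow2' : E * E <= 2 ^+ N.
    by rewrite -expRD; have -> : N%:R / 4 + N%:R / 4 = N%:R / 2 :> R by field.
  apply: (@le_trans _ _ (2 * N%:R / (E * E) * (2 * y * E))).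
    apply: ler_pM => //; first by rewrite !mulr_ge0 ?invr_ge0 ?exprn_ge0.
      by apply: nbsum_ge0; lra.
    rewrite ler_wpM2l ?mulr_ge0 // lef_pV2 ?posrE ?exprn_gt0 ?mulr_gt0 //.
  have -> : 2 * N%:R / (E * E) * (2 * y * E) = y * (4 * N%:R / E).
    by field; rewrite gt_eqF.
  have -> : 128 * y * q = y * (128 * q) by ring.
  rewrite ler_pM2l // ler_pdivrMr //.
  apply: (@le_trans _ _ (128 * q * (N%:R ^+ 2 / 32))); last by rewrite ler_pM2l //; lra.
  have -> : 128 * q * (N%:R ^+ 2 / 32) = 4 * N%:R * (q * N%:R) by field.
  rewrite ler_peMr ?mulr_ge0 //.
  by rewrite -[leLHS]qd ler_pM2l.
apply: (@le_trans _ _ (nbsum c q N.+1 + (\sum_(k < N.+1) k%:R ^+ 2 * nbterm c q k) / N%:R ^+ 2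
    + 2 * N%:R / 2 ^+ N * nbsum c (4 * q) N.+1)).
  rewrite /nbsum mulr_suml mulr_sumr -!big_split /=; apply: ler_sum => k _.
  have t0 : 0 <= nbterm c q k by apply: nbterm_ge0 => //; lra.
  apply: le_trans (ler_wpM2l t0 (weight_le N0 _)) _; first by rewrite -ltnS.
  rewrite -nbterm_scale le_eqVlt; apply/orP; left; apply/eqP.
  have n2 : (2 : R) ^+ N != 0 by rewrite expf_neq0 // pnatr_eq0.
  by field; rewrite n2 gt_eqF.
have h2 : (\sum_(k < N.+1) k%:R ^+ 2 * nbterm c q k) / N%:R ^+ 2 <= 4 * y * q.
  by rewrite ler_pdivrMr // exprn_gt0.
have h1 : nbsum c q N.+1 <= y * (1 + 2 * q) by apply: le_trans (U1 _) _; rewrite ler_pM2l.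
lra.
Qed.

End WeightedSum.

(** * From the overlap sum to the negative binomial law *)

Section OverlapSum.
Variable R : realType.

(** The layers that agree with a given one at exactly 2k of the 2N vertices, times the pairings that
    preserve both layers when loops are allowed outside their union. *)
Definition overlap_term (N d k : nat) : R :=
  ('C(2 * N, 2 * k) * d ^ (2 * N - 2 * k))%:R *
  ((oddfact k)%:R * (oddfact (N - k))%:R ^+ 2 * (oddfact (N * d.-1 + k))%:R).

(** [bin_double] absorbs one of the two factors [oddfact (N - k)]; the other yields the ratio of
    [central], and [oddfact_rising] the negative binomial term. *)
Lemma overlap_termE N d k : (k <= N)%N -> (0 < d)%N ->
  overlap_term N d k = (oddfact N)%:R ^+ 2 * (oddfact (N * d.-1))%:R * d%:R ^+ (2 * N) *
    (nbterm ((N * d.-1)%:R + 1 / 2) (d%:R ^- 2) k * (central R (N - k) / central R N)).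
Proof.
move=> kN d0; rewrite /overlap_term oddfact_rising natrM.
have dR : d%:R != 0 :> R by rewrite pnatr_eq0 -lt0n.
have h : ('C(2 * N, 2 * k))%:R * (oddfact k)%:R * (oddfact (N - k))%:R =
    (oddfact N)%:R * ('C(N, k))%:R :> R by rewrite -!natrM bin_double.
have hb : ('C(N, k))%:R * ((k`!)%:R * ((N - k)`!)%:R) = (N`!)%:R :> R.
  by rewrite -!natrM bin_fact.
have -> : (d ^ (2 * N - 2 * k))%:R = d%:R ^+ (2 * N) / d%:R ^+ (2 * k) :> R.
  by rewrite natrX -expfB_cond ?(negbTE dR) //; lia.
rewrite /nbterm /central.
have -> : (2 : R) ^+ N = 2 ^+ k * 2 ^+ (N - k) by rewrite -exprD subnKC.
rewrite exprVn -exprM.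
have f1 := fact_neq0 R k; have f2 := fact_neq0 R (N - k).
have f3 : (oddfact N)%:R != 0 :> R by rewrite pnatr_eq0 -lt0n oddfact_gt0.
have p1 : (2 : R) ^+ k != 0 by rewrite expf_neq0 // pnatr_eq0.
have p2 : (2 : R) ^+ (N - k) != 0 by rewrite expf_neq0 // pnatr_eq0.
have p3 : d%:R ^+ (2 * k) != 0 :> R by rewrite expf_neq0.
rewrite -hb; move: h f1 f2 f3 p1 p2 p3.
have bn0 : ('C(N, k))%:R != 0 :> R by rewrite pnatr_eq0 -lt0n bin_gt0.
move: (oddfact k)%:R (oddfact (N - k))%:R (oddfact N)%:R ('C(N, k))%:R bn0 ('C(_, _))%:R.
move: (2 ^+ k) (2 ^+ (N - k)) (d%:R ^+ (2 * k)) (k`!)%:R ((N - k)`!)%:R (d%:R ^+ (2 * N)).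
move: (oddfact _)%:R (rising _ _) => ofc ri a b e f g dd x v w z z0 c h f0 g0 w0 a0 b0 e0.
transitivity (dd / e * (c * x * v) * v * (ofc * (a * ri))); first by ring.
by rewrite h; field; rewrite ?f0 ?g0 ?w0 ?a0 ?b0 ?e0 ?z0.
Qed.

(** Since 1 - q = (d+1)(d-1)/d^2, the power (1 - q)^(-N(d-1)) coming from the negative binomial sum
    is exactly what [oddfact_ratio_le] compensates. *)
Lemma overlap_sum_le (N d : nat) : (16 <= d)%N -> (d ^ 2 <= N)%N ->
  (oddfact (N * d.+1))%:R *
    \sum_(k < N.+1) overlap_term N d k * expR (- (k%:R / N%:R / 2)) <=
  expR N%:R^-1 * (1 + 134 * d%:R ^- 2) *
    (d.+1%:R ^+ (2 * N) * (oddfact N)%:R ^+ 2 * (oddfact (N * d))%:R ^+ 2).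
Proof.
move=> d16 dN; have d0 : (0 < d)%N by lia.
have N0 : (0 < N)%N by nia.
set q : R := d%:R ^- 2.
have dR : 16 <= d%:R :> R by rewrite (ler_nat _ 16).
have eR : d.-1%:R = d%:R - 1 :> R by rewrite -subn1 natrB.
have DR : d.+1%:R = d%:R + 1 :> R by rewrite -(natr1 d).
have qE : 1 - q = d.+1%:R * d.-1%:R / d%:R ^+ 2.
  by rewrite eR DR /q; field; lra.
have d2 : 0 < d%:R ^+ 2 :> R by rewrite exprn_gt0; lra.
have p0 : 0 < 1 - q.
  by rewrite qE divr_gt0 ?mulr_gt0 //; lra.
have -> : \sum_(k < N.+1) overlap_term N d k * expR (- (k%:R / N%:R / 2)) =
    (oddfact N)%:R ^+ 2 * (oddfact (N * d.-1))%:R * d%:R ^+ (2 * N) *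
    \sum_(k < N.+1) nbterm ((N * d.-1)%:R + 1 / 2) q k * weight R N k.
  rewrite mulr_sumr; apply: eq_bigr => k _; rewrite overlap_termE //; last by rewrite -ltnS.
  by rewrite /weight !mulrA.
have := weighted_nbsum_le R d16 dN; rewrite -/q.
set S := \sum_(k < _) _ => hS.
have of0 M : 0 < (oddfact M)%:R :> R by rewrite ltr0n oddfact_gt0.
have hst := oddfact_ratio_le R N0 (_ : (1 < d)%N).
set A := (oddfact (N * d.+1))%:R in hst *; set B := (oddfact (N * d.-1))%:R in hst *.
set C := (oddfact (N * d))%:R in hst *; set F := (oddfact N)%:R.
have A0 : 0 < A := of0 _; have B0 : 0 < B := of0 _.
have F0 : 0 < F := of0 _.
have q1 : 0 < 1 + 134 * q by rewrite ltr_pwDl // mulr_ge0 // invr_ge0 ltW.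
have key : A * B * d%:R ^+ (2 * N) * (1 - q) ^- (N * d.-1) <= expR N%:R^-1 * C ^+ 2 * d.+1%:R ^+ (2 * N).
  rewrite ler_pdivrMr ?exprn_gt0 // qE exprMn exprVn -exprM mulrA ler_pdivlMr ?exprn_gt0 //; last by lra.
  have := hst ltac:(lia).
  have -> : (2 * (N * d) = 2 * N + 2 * (N * d.-1))%N by nia.
  have -> : (N * d.+1 = 2 * N + N * d.-1)%N by nia.
  by rewrite !exprD exprMn !mulrA.
have -> : A * (F ^+ 2 * B * d%:R ^+ (2 * N) * S) = F ^+ 2 * (A * B * d%:R ^+ (2 * N) * S) by ring.
have -> : expR N%:R^-1 * (1 + 134 * q) * (d.+1%:R ^+ (2 * N) * F ^+ 2 * C ^+ 2) =
  F ^+ 2 * (expR N%:R^-1 * C ^+ 2 * d.+1%:R ^+ (2 * N) * (1 + 134 * q)) by ring.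
rewrite ler_pM2l ?exprn_gt0 //.
apply: (@le_trans _ _ (A * B * d%:R ^+ (2 * N) * ((1 - q) ^- (N * d.-1) * (1 + 134 * q)))).
  by rewrite ler_wpM2l // ltW // !mulr_gt0 ?exprn_gt0 //; lra.
by rewrite mulrA ler_pM2r.
Qed.

(* The three terms are the loop exponents [- sum_v C(d_v, 2) / #points] of
   P_*(n, d + 1), of what remains after removing two layers that agree at [a]
   vertices and, twice, of P_*(n, d); up to the error terms their sum is
   [- a d / (2 (n (d - 1) + a))]. *)
Lemma exponent_le (n d a : R) : 16 <= n -> 2 <= d -> 0 <= a <= n ->
  - (n * ((d + 1) * d) / 2 / (n * (d + 1) + 2 * d)) -
  (a * (d * (d - 1)) + (n - a) * ((d - 1) * (d - 2))) / 2 / (n * (d - 1) + a + 2 * d) +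
  2 * (n * (d * (d - 1)) / 2 / (n * d - 3 * d - 2)) <=
  - (a / n / 2) + 10 * d / n.
Proof.
move=> n16 d2 /andP[a0 an].
have n0 : 0 < n by lra.
have d0 : 0 < d by lra.
have nd : 32 <= n * d by nra.
have nd1 : 0 < n * (d - 1) by rewrite mulr_gt0 //; lra.
(* The leading terms d/2, (d-2)/2 + a/(2n) and d - 1 of [h1], [h2] and [h3] leave only -a/(2n), and
   the errors d/n, d/n and 8d/n make up the constant 10. *)
have h1 : d / 2 - d / n <= n * ((d + 1) * d) / 2 / (n * (d + 1) + 2 * d).
  have -> : d / 2 - d / n = d * (n - 2) / (2 * n) by field; lra.
  have p : 0 < n * (d + 1) + 2 * d by nra.
  rewrite ler_pdivlMr // mulrAC ler_pdivrMr; last by lra.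
  have -> : n * ((d + 1) * d) / 2 * (2 * n) = d * (n * n * (d + 1)) by field.
  have -> : d * (n - 2) * (n * (d + 1) + 2 * d) =
    d * (n * n * (d + 1) - 2 * n - 4 * d) by ring.
  by rewrite ler_pM2l //; lra.
have h3 : 2 * (n * (d * (d - 1)) / 2 / (n * d - 3 * d - 2)) <= d - 1 + 8 * d / n.
  have p : 0 < n * d - 3 * d - 2 by nra.
  have -> : 2 * (n * (d * (d - 1)) / 2 / (n * d - 3 * d - 2)) =
    n * (d * (d - 1)) / (n * d - 3 * d - 2) by field; lra.
  rewrite ler_pdivrMr // -subr_ge0.
  have -> : (d - 1 + 8 * d / n) * (n * d - 3 * d - 2) - n * (d * (d - 1)) =
    8 * d * d - (d - 1) * (3 * d + 2) - 8 * d / n * (3 * d + 2) by field; lra.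
  have : 8 * d / n * (3 * d + 2) <= d / 2 * (3 * d + 2).
    rewrite ler_pM2r; last by lra.
    by rewrite ler_pdivrMr //; nra.
  nra.
have h2 : (d - 2) / 2 + a / n / 2 - d / n <=
  (a * (d * (d - 1)) + (n - a) * ((d - 1) * (d - 2))) / 2 / (n * (d - 1) + a + 2 * d).
  set s := n * (d - 1) + a.
  have s0 : 0 < s by rewrite /s; lra.
  have s2 : 0 < s + 2 * d by lra.
  have -> : a * (d * (d - 1)) + (n - a) * ((d - 1) * (d - 2)) =
      (d - 2) * s + a * d by rewrite /s; ring.
  have g1 : (d - 2) / 2 + a / n / 2 <= ((d - 2) * s + a * d) / 2 / s.
    have -> : ((d - 2) * s + a * d) / 2 / s = (d - 2) / 2 + a * (d / s) / 2 by field; lra.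
    rewrite lerD2l ler_pM2r ?invr_gt0 // ler_wpM2l //.
    by rewrite ler_pdivlMr // mulrC ler_pdivrMr // /s; lra.
  have g2 : ((d - 2) * s + a * d) / 2 / s - d / n <= ((d - 2) * s + a * d) / 2 / (s + 2 * d).
    rewrite lerBlDl -lerBlDr.
    have -> : ((d - 2) * s + a * d) / 2 / s - ((d - 2) * s + a * d) / 2 / (s + 2 * d) =
      d * (((d - 2) * s + a * d) / s / (s + 2 * d)) by field; lra.
    rewrite ler_pM2l // ler_pdivrMr // ler_pdivrMr //.
    have : n * ((d - 2) * s + a * d) <= (s + 2 * d) * s.
      rewrite -subr_ge0.
      have -> : (s + 2 * d) * s - n * ((d - 2) * s + a * d) =
        n * (n * (d - 1)) + a ^+ 2 + 2 * d * s by rewrite /s; ring.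
      by have := ltW (mulr_gt0 n0 nd1); have := sqr_ge0 a; have := ltW (mulr_gt0 d0 s0); lra.
    by rewrite [n^-1 * _]mulrC mulrAC ler_pdivlMr // [_ * n]mulrC.
  lra.
by move: h1 h2 h3; move: (_ / (n * (d + 1) + 2 * d)) (_ / (n * (d - 1) + a + 2 * d)) (2 * (_ / (n * d - 3 * d - 2))) => X Y Z; lra.
Qed.

End OverlapSum.

Lemma big_even_ord (R : nmodType) (N : nat) (F : nat -> R) :
  (forall a, odd a -> F a = 0) ->
  \sum_(a < (2 * N).+1) F a = \sum_(k < N.+1) F (2 * k)%N.
Proof.
move=> Fodd; elim: N => [|N IH]; first by rewrite muln0 !big_ord1.
have -> : (2 * N.+1 = (2 * N).+2)%N by lia.
rewrite big_ord_recr big_ord_recr /= IH [in RHS]big_ord_recr /=.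
rewrite Fodd ?addr0; last by rewrite /= oddM.
by congr (_ + F _); lia.
Qed.

(** * The normalized second moment *)

Section Ratio.
Variables (R : realType) (N d : nat).
Let n := (2 * N)%N.
Hypotheses (n16 : (16 <= n)%N) (d2 : (2 <= d)%N).
Notation L := [set g : pairingfun n d.+1 | is_loopless_pairing g].
Notation Q := (super_support n d).

Let l1 : R := n%:R * ((d%:R + 1) * d%:R) / 2 / (n%:R * (d%:R + 1) + 2 * d%:R).
Let l2 : R := n%:R * (d%:R * (d%:R - 1)) / 2 / (n%:R * d%:R - 3 * d%:R - 2).
Let la (a : nat) : R :=
  (a%:R * (d%:R * (d%:R - 1)) + (n%:R - a%:R) * ((d%:R - 1) * (d%:R - 2))) / 2 /
  (n%:R * (d%:R - 1) + a%:R + 2 * d%:R).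

Lemma pred_natr : d.-1%:R = d%:R - 1 :> R.
Proof. by rewrite -subn1 natrB //; lia. Qed.

Lemma pred2_natr : d.-2%:R = d%:R - 2 :> R.
Proof. by rewrite -subn2 natrB. Qed.

Lemma ncomplete_double j : ncomplete (2 * j) = oddfact j.
Proof. by rewrite /ncomplete oddM mul2n doubleK. Qed.

Lemma card_loopless_le : (#|L|%:R : R) <= (oddfact (N * d.+1))%:R * expR (- l1).
Proof.
rewrite card_loopless distinct_bins_loopless.
have := @loopless_le _ _ fst R (setT : {set point n d.+1}) d (fun x _ => siblings_le_point _ x).
rewrite cardsT card_prod !card_ord => /(_ ltac:(nia) _ (subxx _)).
have -> : (n * d.+1 = 2 * (N * d.+1))%N by rewrite /n mulnA.
rewrite ncomplete_double loop_pairs_setT.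
have -> : (n * (d.+1 * d))%:R / 2 / ((2 * (N * d.+1))%:R + 2 * d%:R) = l1 :> R.
  by rewrite [(2 * (N * d.+1))%N]mulnA -/n /l1 !natrM -(natr1 d).
exact.
Qed.

Lemma rest_le (i j : {ffun 'I_n -> 'I_d.+1}) (a := #|agreement i j|) : ~~ odd a ->
  ((nmatchings (@distinct_bins n d) (~: (layer i :|: layer j)))%:R : R) <=
  (oddfact (N * d.-1 + a./2))%:R * expR (- la a).
Proof.
move=> ae; have an : (a <= n)%N by rewrite -[n in (_ <= n)%N]card_ord max_card.
have aE : a = (2 * a./2)%N by rewrite mul2n even_halfK.
have cT : #|~: (layer i :|: layer j)| = (n * d.-1 + a)%N.
  by rewrite card_rest -/a; nia.
rewrite distinct_bins_loopless.
have := @loopless_le _ _ fst R (~: (layer i :|: layer j)) d (fun x _ => siblings_le_point _ x).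
rewrite cT => /(_ ltac:(nia) _ (subxx _)).
have -> : (n * d.-1 + a = 2 * (N * d.-1 + a./2))%N by rewrite {1}aE /n; lia.
rewrite ncomplete_double loop_pairs_rest -/a.
have -> : (2 * (N * d.-1 + a./2))%:R = n%:R * (d%:R - 1) + a%:R :> R.
  by rewrite mulnDr -aE mulnA natrD natrM pred_natr.
have -> : (a * (d * d.-1) + (n - a) * (d.-1 * d.-2))%:R / 2 /
   (n%:R * (d%:R - 1) + a%:R + 2 * d%:R) = la a.
  by rewrite /la natrD !natrM (natrB _ an) pred_natr pred2_natr /n natrM.
exact.
Qed.

Lemma layer_rest_ge (i : {ffun 'I_n -> 'I_d.+1}) :
  (oddfact (N * d))%:R * expR (- l2) <=
  ((nmatchings (@distinct_bins n d) (~: layer i))%:R : R).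
Proof.
rewrite -[layer i]setUid distinct_bins_loopless.
have cT : #|~: (layer i :|: layer i)| = (n * d)%N.
  by rewrite card_rest agreement_id cardsT card_ord subnn addn0.
have := @loopless_ge _ _ fst R (~: (layer i :|: layer i)) d (fun x _ => siblings_le_point _ x).
rewrite cT => /(_ ltac:(nia) _ (subxx _)).
have -> : (n * d = 2 * (N * d))%N by rewrite /n mulnA.
rewrite ncomplete_double loop_pairs_rest agreement_id cardsT card_ord subnn addn0.
have -> : (n * (d * d.-1))%:R / 2 / ((2 * (N * d))%:R - 3 * d%:R - 2) = l2 :> R.
  by rewrite [(2 * (N * d))%N]mulnA -/n /l2 !natrM pred_natr.
exact.
Qed.

Lemma super_support_ge :
  (oddfact N)%:R * ((oddfact (N * d))%:R * expR (- l2)) <= (#|Q|%:R : R).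
Proof.
by rewrite /super_support card_preserves natrM /n ncomplete_double ler_wpM2l ?layer_rest_ge.
Qed.

Lemma super_support_gt0 : (0 < #|Q|)%N.
Proof.
rewrite -(ltr0n R); apply: lt_le_trans super_support_ge.
by rewrite !mulr_gt0 ?expR_gt0 // ltr0n oddfact_gt0.
Qed.

Lemma loopless_gt0 : (0 < #|L|)%N.
Proof.
apply: leq_trans super_support_gt0 _; apply/subset_leq_card/subsetP => g.
by rewrite !inE => /andP[].
Qed.

Lemma second_moment_le :
  second_moment R n d <= d.+1%:R ^+ n * \sum_(k < N.+1) overlap_term R N d k * expR (- la (2 * k)).
Proof.
(* The common part of two preserved layers is matched within itself, so an odd agreement contributes
   nothing and only overlaps 2k remain. *)
pose h (a : nat) : R := if odd a then 0 else
  (oddfact a./2)%:R * (oddfact (N - a./2))%:R ^+ 2 *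
  ((oddfact (N * d.-1 + a./2))%:R * expR (- la a)).
have step (i j : {ffun 'I_n -> 'I_d.+1}) :
    #|[set g | [&& is_loopless_pairing g, preserves i g & preserves j g]]|%:R <= h #|agreement i j|.
  rewrite card_preserves2E /h; set a := #|agreement i j|.
  case: ifP => ao; first by rewrite {1}/ncomplete ao !mul0n.
  have aE : a = (2 * a./2)%N by rewrite mul2n even_halfK ?ao.
  have nE : (n - a = 2 * (N - a./2))%N by rewrite {1}aE /n; lia.
  have cE : ncomplete a = oddfact a./2 by rewrite {1}aE ncomplete_double.
  rewrite nE cE ncomplete_double natrM natrM natrX ler_wpM2l // ?mulr_ge0 ?exprn_ge0 //.
  by apply: rest_le; rewrite -/a ao.
apply: (@le_trans _ _ (\sum_(i : {ffun 'I_n -> 'I_d.+1}) \sum_(j : {ffun 'I_n -> 'I_d.+1}) h #|agreement i j|)).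
  by apply: ler_sum => i _; apply: ler_sum => j _; exact: step.
under eq_bigr do rewrite sum_over_agreement.
rewrite sumr_const card_ffun !card_ord -natrX mulr_natl ler_wMn2r //.
rewrite (@big_even_ord R N (fun a => ('C(n, a) * d ^ (n - a))%:R * h a)); last first.
  by move=> a ao; rewrite /h ao mulr0.
rewrite le_eqVlt; apply/orP; left; apply/eqP; apply: eq_bigr => k _.
have k2 : ((2 * k)%N)./2 = k :> nat by rewrite mul2n doubleK.
by rewrite /h oddM k2 /= /overlap_term -/n !mulrA.
Qed.

(** The loop factor of two layers depends on their overlap, so the exponents are combined by
    [exponent_le] inside the sum, for each k. *)
Lemma ratio_le : (16 <= d)%N -> (d ^ 2 <= N)%N ->
  #|L|%:R * second_moment R n d <=
  expR (10 * d%:R / n%:R + N%:R^-1) * (1 + 134 * d%:R ^- 2) *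
    (d.+1%:R ^+ n * #|Q|%:R) ^+ 2.
Proof.
move=> d16 dN.
set D := d.+1%:R ^+ n; have D0 : 0 < D by rewrite exprn_gt0.
have nR : 16 <= n%:R :> R by rewrite (ler_nat _ 16).
have dR : 2 <= d%:R :> R by rewrite (ler_nat _ 2).
set A : R := (oddfact (N * d.+1))%:R; have A0 : 0 < A by rewrite ltr0n oddfact_gt0.
pose E : R := expR (10 * d%:R / n%:R).
have ex k : (k <= N)%N ->
    expR (- l1) * expR (- la (2 * k)) <= E * expR (- l2) ^+ 2 * expR (- (k%:R / N%:R / 2)).
  move=> kN; have NR : 0 < N%:R :> R by rewrite ltr0n; move: n16; rewrite /n; lia.
  have := @exponent_le R n%:R d%:R (2 * k)%:R nR dR.
  rewrite ler0n ler_nat leq_mul2l kN => /(_ isT).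
  have -> : (2 * k)%:R / n%:R / 2 = k%:R / N%:R / 2 :> R.
    by rewrite /n !natrM; field; rewrite gt_eqF.
  rewrite -/l1 -/l2 -/(la (2 * k)) => h.
  rewrite /E expr2 -!expRD ler_expR; lra.
apply: (@le_trans _ _ (A * expR (- l1) * (D * \sum_(k < N.+1) overlap_term R N d k * expR (- la (2 * k))))).
  apply: ler_pM => //; [|exact: card_loopless_le|exact: second_moment_le].
  by apply: sumr_ge0 => i _; apply: sumr_ge0.
apply: (@le_trans _ _ (D * (E * expR (- l2) ^+ 2) * (A * \sum_(k < N.+1) overlap_term R N d k * expR (- (k%:R / N%:R / 2))))).
  have -> : A * expR (- l1) * (D * \sum_(k < N.+1) overlap_term R N d k * expR (- la (2 * k))) =
    (D * A) * (expR (- l1) * \sum_(k < N.+1) overlap_term R N d k * expR (- la (2 * k))) by ring.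
  have -> : D * (E * expR (- l2) ^+ 2) * (A * \sum_(k < N.+1) overlap_term R N d k * expR (- (k%:R / N%:R / 2))) =
    (D * A) * ((E * expR (- l2) ^+ 2) * \sum_(k < N.+1) overlap_term R N d k * expR (- (k%:R / N%:R / 2))) by ring.
  apply: ler_wpM2l; first by rewrite mulr_ge0 // ltW.
  rewrite !mulr_sumr; apply: ler_sum => k _.
  rewrite mulrCA [leRHS]mulrCA; apply: ler_wpM2l; last by apply: ex; rewrite -ltnS.
  by rewrite /overlap_term !mulr_ge0 ?exprn_ge0.
apply: le_trans (ler_wpM2l _ (overlap_sum_le R d16 dN)) _.
  by rewrite !mulr_ge0 ?expR_ge0 ?exprn_ge0 ?expR_ge0 ?(ltW D0).
rewrite expRD -/E.
have h := super_support_ge.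
set q := 1 + 134 * _; set B := oddfact N in h *; set C := oddfact (N * d) in h *.
have h2 : (B%:R * (C%:R * expR (- l2))) ^+ 2 <= #|Q|%:R ^+ 2 :> R.
  by rewrite lerXn2r ?nnegrE ?mulr_ge0 ?expR_ge0.
have -> : D * (E * expR (- l2) ^+ 2) * (expR N%:R^-1 * q * (D * B%:R ^+ 2 * C%:R ^+ 2)) =
  E * expR N%:R^-1 * q * D ^+ 2 * (B%:R * (C%:R * expR (- l2))) ^+ 2 by ring.
have -> : E * expR N%:R^-1 * q * (D * #|Q|%:R) ^+ 2 =
  E * expR N%:R^-1 * q * D ^+ 2 * #|Q|%:R ^+ 2 by ring.
apply: ler_wpM2l h2.
rewrite !mulr_ge0 ?expR_ge0 ?exprn_ge0 ?(ltW D0) //.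
by rewrite addr_ge0 // mulr_ge0 // invr_ge0 exprn_ge0.
Qed.

End Ratio.

(** * Final constants *)

Lemma expR_le1D2 (R : realType) (x : R) : 0 <= x <= 1 / 2 -> expR x <= 1 + 2 * x.
Proof.
case/andP=> x0 x1; have h := expR_ge1Dx (- x); rewrite expRN in h.
apply: (@le_trans _ _ (1 - x)^-1).
  by rewrite -[leLHS]invrK lef_pV2 ?posrE ?invr_gt0 ?expR_gt0 //; lra.
by rewrite -[leLHS]mul1r ler_pdivrMr; nra.
Qed.

(** With q = 1/d^2, the bounds on d give 10d/n <= 10q and 1/N <= q; then (1 + 22q)(1 + 134q) <= 1 +
    168q since q <= 1/256. *)
Lemma ratio_excess_le (R : realType) (N d : nat) (W : R)
    (L := #|[set g : pairingfun (2 * N) d.+1 | is_loopless_pairing g]|%:R : R) :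
  (16 <= d)%N -> (d ^ 2 <= N)%N -> (d ^ 3 <= 2 * N)%N ->
  W = d.+1%:R ^+ (2 * N) * #|super_support (2 * N) d|%:R ->
  L * second_moment R (2 * N) d / W ^+ 2 - 1 <= 168 * d%:R ^- 2.
Proof.
move=> d16 dN dN3 WE.
have n16 : (16 <= 2 * N)%N by nia.
have d2 : (2 <= d)%N by lia.
have W0 : 0 < W.
  by rewrite WE mulr_gt0 ?exprn_gt0 ?ltr0n // (super_support_gt0 R).
have := ratio_le R n16 d2 d16 dN; rewrite -WE -/L => h.
have dR : 16 <= d%:R :> R by rewrite (ler_nat _ 16).
have d0 : 0 < d%:R :> R by lra.
have dNR : d%:R ^+ 2 <= N%:R :> R by rewrite -natrX ler_nat.
have dNR3 : d%:R ^+ 3 <= (2 * N)%:R :> R by rewrite -natrX ler_nat.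
have d2R : 256 <= d%:R ^+ 2 :> R by rewrite expr2; nra.
have nR : 0 < (2 * N)%:R :> R by rewrite ltr0n; lia.
set q : R := d%:R ^- 2 in h *.
have q0 : 0 < q by rewrite invr_gt0 exprn_gt0.
have q1 : q <= 1 / 256 by rewrite /q -div1r ler_pdivrMr; lra.
have d2R0 : 0 < d%:R ^+ 2 :> R by lra.
have NR0 : 0 < N%:R :> R by lra.
have e1 : N%:R^-1 <= q by rewrite lef_pV2 ?posrE.
have e2 : 10 * d%:R / (2 * N)%:R <= 10 * q.
  rewrite -mulrA ler_pM2l // ler_pdivrMr //.
  have -> : d%:R = q * d%:R ^+ 3 by rewrite /q; field; rewrite gt_eqF.
  by rewrite ler_pM2l.
rewrite lerBlDr ler_pdivrMr ?exprn_gt0 //; apply: le_trans h _.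
rewrite ler_pM2r ?exprn_gt0 //.
apply: (@le_trans _ _ ((1 + 2 * (11 * q)) * (1 + 134 * q))); last by nra.
rewrite ler_pM2r; last by lra.
apply: (@le_trans _ _ (expR (11 * q))); first by rewrite ler_expR; lra.
by apply: expR_le1D2; lra.
Qed.

Lemma ln_ge_1BV (R : realType) (x : R) : 0 < x -> 1 - x^-1 <= ln x.
Proof.
move=> x0; have p : 0 < x^-1 by rewrite invr_gt0.
have := @le_ln1Dx R (x^-1 - 1) ltac:(lra).
by rewrite addrC subrK lnV ?posrE //; lra.
Qed.

Lemma degree_pow7_le (R : realType) (n d : nat) : (16 <= n)%N ->
  d%:R <= n%:R `^ (7%:R)^-1 / ln n%:R :> R -> (d ^ 7 <= n)%N.
Proof.
move=> n16 h.
have nR : 16 <= n%:R :> R by rewrite (ler_nat _ 16).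
have ln1 : 1 <= ln n%:R :> R.
  apply: (@le_trans _ _ (ln (2 ^+ 4))); last by rewrite ler_ln ?posrE; lra.
  have := @ln_ge_1BV R 2 ltac:(lra); rewrite lnXn; [lra | lra].
have {}h : d%:R <= n%:R `^ (7%:R)^-1 :> R.
  by apply: le_trans h _; rewrite ler_piMr ?powR_ge0 // invf_le1; lra.
rewrite -(ler_nat R) natrX.
have -> : n%:R = (n%:R `^ (7%:R)^-1) ^+ 7 :> R.
  by rewrite -powR_mulrn ?powR_ge0 // -powRrM mulVf ?pnatr_eq0 // powRr1.
by rewrite lerXn2r ?nnegrE ?powR_ge0.
Qed.

Unset Implicit Arguments.

Theorem mainTheorem5 (R : realType) (d : nat -> nat)
  (hd3 : forall n : nat, ~~ odd n -> (3 <= d n)%N)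
  (hdo : forall eps : R, 0 < eps -> exists N : nat, forall n : nat,
           (N <= n)%N -> ~~ odd n ->
           (d n)%:R <= eps * (n%:R `^ (7%:R)^-1 / ln n%:R)) :
  exists C : R, exists N : nat, forall n : nat, (N <= n)%N -> ~~ odd n ->
    exists mu : pairingfun n (d n).+1 * pairingfun n (d n).+1 -> R,
      is_coupling (@law_super R n (d n)) (@law_Pstar R n (d n).+1) mu /\
      1 - C * (ln (d n)%:R / (d n)%:R)
        <= \sum_(z : pairingfun n (d n).+1 * pairingfun n (d n).+1
                 | multigraph z.1 == multigraph z.2) mu z.
Proof.
have [N0 hN0] := hdo 1 ltr01.
(* For degree at least 16 the error is at most 85/d, and ln d >= 2/3 gives 85 <= 128 * (2/3). *)
exists 128, (maxn 16 N0) => n; rewrite geq_max => /andP[n16 nN0] n_even.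
have d3 := hd3 n n_even; have := hN0 n nN0 n_even; rewrite mul1r.
move: (d n) d3 => e e3 /(degree_pow7_le n16) e7 {hd3 hdo hN0 N0 nN0 d}.
have nE : n = (2 * n./2)%N by rewrite mul2n even_halfK.
move: (n./2) nE => N nE; subst n.
have e2 : (2 <= e)%N by lia.
have eR : 3 <= e%:R :> R by rewrite (ler_nat _ 3).
have eta0 : 0 < e%:R^-1 :> R by rewrite invr_gt0; lra.
have lne : 2 / 3 <= ln e%:R :> R.
  have := @ln_ge_1BV R e%:R ltac:(lra).
  have : e%:R^-1 <= 1 / 3 :> R by rewrite -div1r ler_pdivrMr; lra.
  by lra.
(* Taking [eta] = 1/d makes both [eta] and 168 / (d^2 * eta) of order 1/d. *)
have [mu [cmu hmu]] := coupling_of_second_moment (super_support_gt0 R n16 e2)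
  (loopless_gt0 R n16 e2) eta0.
exists mu; split=> //.
have [e16|e16] := ltnP e 16.
  (* For degree at most 15 the required bound is negative, since 128 * (2/3) / 15 > 1. *)
  apply: le_trans (_ : 0 <= _); last by apply: sumr_ge0 => z _; case: cmu.
  have e15 : e%:R <= 15 :> R by rewrite (ler_nat _ _ 15).
  rewrite subr_le0 mulrA ler_pdivlMr; lra.
apply: le_trans hmu; apply: lerB => //.
have h : (e ^ 2 * e ^ 5 = e ^ 7)%N by rewrite -expnD.
have h' : (e ^ 3 * e ^ 4 = e ^ 7)%N by rewrite -expnD.
have p4 : (1 <= e ^ 4)%N by rewrite expn_gt0; lia.
have p5 : (2 <= e ^ 5)%N by rewrite (@leq_trans (2 ^ 5)) // leq_exp2r.
have := @ratio_excess_le R N e _ e16 ltac:(nia) ltac:(nia) (erefl _).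
set X := _ - 1; move=> hX.
have q : e%:R ^- 2 = e%:R^-1 * e%:R^-1 :> R by rewrite -exprVn expr2.
have : X / e%:R^-1 <= 168 * e%:R^-1.
  by rewrite ler_pdivrMr // -mulrA -q.
move=> h1; apply: (@le_trans _ _ (85 * e%:R^-1)); first by lra.
by rewrite mulrA ler_pM2r //; lra.
Qed.
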